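(* Let $M$ be a compact metric space, $L$ a compact space, $\kappa$ an ordinal, $\{r_\xi:\xi<\kappa\}$ a family of distinct points of $L$, and for each $\xi<\kappa$ let $f_\xi: L\setminus\{r_\xi\}\to M$ be continuous. Let $K$ be the split $L$ induced by $\{f_\xi:\xi<\kappa\}$. If $\{f_\xi:\xi<\kappa\}$ contains no $M$-independent sequence and $L$ is weakly Radon-Nikodým, then $K$ is weakly Radon-Nikodým.
   Context: The split $L$ induced by $\{f_\xi:\xi<\kappa\}$ is the subspace $K$ of $L^{\{*\}}\times M^\kappa$ consisting of the points $x_{\xi,t}$ ($\xi<\kappa$, $t\in M$) and $x_r$ ($r\in L\setminus\{r_\xi:\xi<\kappa\}$), where $x_{\xi,t}( * )=r_\xi$, $x_{\xi,t}(\xi)=t$, $x_{\xi,t}(\eta)=f_\eta(r_\xi)$ for $\eta\neq\xi$, and $x_r( * )=r$, $x_r(\xi)=f_\xi(r)$ for all $\xi<\kappa$. A sequence of pairs of disjoint sets $(A_n^0,A_n^1)$ is independent if $A_1^{\varepsilon_1}\cap\cdots\cap A_m^{\varepsilon_m}\neq\emptyset$ for all $m$ and all $\varepsilon_i\in\{0,1\}$. A sequence of functions $g_n$ from a set into $M$ is $M$-independent if there are disjoint closed $C,C'\subseteq M$ with $(g_n^{-1}(C),g_n^{-1}(C'))_n$ independent. A sequence $f_{\xi_n}$ (distinct $\xi_n$) is $M$-independent if there exist (not necessarily continuous) extensions $g_{\xi_n}:L\to M$ of $f_{\xi_n}$ forming an $M$-independent sequence. A compact space is weakly Radon-Nikodým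 if it is homeomorphic to a weak$^*$ compact subset of the dual $X^*$ of a Banach space $X$ containing no isomorphic copy of $\ell_1$. *)

(* Defs.v *)
From HB Require Import structures.
From mathcomp Require Import all_boot all_order all_algebra.
From mathcomp Require Import all_classical all_reals all_analysis.
Set Implicit Arguments. Unset Strict Implicit. Unset Printing Implicit Defensive.
Import Order.TTheory GRing.Theory Num.Theory.
Import numFieldNormedType.Exports.
Local Open Scope classical_set_scope.
Local Open Scope ring_scope.

Definition in_l1 {R : realType} (a : nat -> R) : Prop :=
  cvgn (series (fun k => `|a k|)).

Definition l1norm {R : realType} (a : nat -> R) : R :=
  limn (series (fun k => `|a k|)).

Definition contains_l1 {R : realType} (X : normedModType R) : Prop :=
  exists (T : (nat -> R) -> X) (c C : R),
    0 < c /\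
    (forall (lam : R) (a b : nat -> R), in_l1 a -> in_l1 b ->
        T (fun k => lam * a k + b k) = lam *: T a + T b) /\
    (forall a, in_l1 a -> c * l1norm a <= `|T a| /\ `|T a| <= C * l1norm a).

(* x : X -> R is an element of the dual X^* (continuous linear functional).
   The weak* topology on X^* is the topology of pointwise convergence,
   i.e. the subspace topology inherited from {ptws X -> R}. *)
Definition in_dual {R : realType} (X : normedModType R) (x : {ptws X -> R}) : Prop :=
  (forall (lam : R) (u v : X), x (lam *: u + v) = lam * x u + x v) /\
  continuous (x : X -> R).

Definition weakly_RN_set {R : realType} {T : topologicalType} (S : set T) : Prop :=
  exists (X : completeNormedModType R) (D : set {ptws X -> R})
         (e : T -> {ptws X -> R}) (g : {ptws X -> R} -> T),
    ~ contains_l1 X /\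
    D `<=` in_dual (X := X) /\
    compact D /\
    e @` S = D /\ g @` D = S /\
    {in S, cancel e g} /\ {in D, cancel g e} /\
    {within S, continuous e} /\ {within D, continuous g}.

Definition weakly_RN {R : realType} (K : topologicalType) : Prop :=
  @weakly_RN_set R K [set: K].

(* a sequence of pairs of disjoint sets (A0 n, A1 n) is independent
   (indexed from 0 instead of 1) *)
Definition independent_pairs {T : Type} (A0 A1 : nat -> set T) : Prop :=
  (forall n, A0 n `&` A1 n = set0) /\
  forall (m : nat) (eps : nat -> bool),
    exists x, forall i, (i < m)%N -> (if eps i then A1 i else A0 i) x.

Definition M_independent_seq {Z : Type} {M : topologicalType}
    (g : nat -> Z -> M) : Prop :=
  exists C C' : set M, closed C /\ closed C' /\ C `&` C' = set0 /\
    independent_pairs (fun n => g n @^-1` C) (fun n => g n @^-1` C').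

(* the family {f_i : L \ {r_i} -> M} contains an M-independent sequence:
   a sequence f_{xi n} with distinct xi n admitting (not necessarily
   continuous) extensions g_n : L -> M forming an M-independent sequence. *)
Definition has_M_independent_seq {I : Type} {L M : topologicalType}
    (r : I -> L) (f : I -> L -> M) : Prop :=
  exists (xi : nat -> I) (g : nat -> L -> M),
    injective xi /\
    (forall n x, x <> r (xi n) -> g n x = f (xi n) x) /\
    M_independent_seq g.

(* the underlying set of the split L induced by {f_i}, as a subset of
   L^{*} x M^I, with L x (I -> M) carrying the product topology:
   x_{i,t} = (r_i, eta |-> f_eta (r_i) for eta <> i, t at i), and
   x_l = (l, eta |-> f_eta l) for l not among the r_i. *)
Definition split_set {I : Type} {L M : topologicalType} (r : I -> L)
    (f : I -> L -> M) : set (L * {ptws I -> M})%type :=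
  [set x | (exists i, x.1 = r i /\ forall j, j <> i -> x.2 j = f j (r i)) \/
           ((forall i, x.1 <> r i) /\ forall i, x.2 i = f i x.1)].

(* Main.v *)
(* The set K is closed in L x M^I. If L embeds in the dual of X, the points of K
   are separated by the functions x o pr_L, with x in the unit ball of X, and
   d(z, .) o pr_i, with z in M. No independent sequence can be extracted from
   these functions: for the former it would generate l_1 in X, for the latter
   it would be an M-independent sequence of functions f_i.

   A uniformly bounded family without independent sequences is totally bounded
   for the L_1 seminorm of the limit, along any ultrafilter, of any sequence of
   finitely additive means, a property inherited by absolutely convex hulls and
   by uniform approximations. Conversely, a sequence that dominates l_1 in the
   supremum norm is uniformly separated in L_1 for such a limit, by a minimax
   argument. Hence the Davis-Figiel-Johnson-Pelczynski interpolation space Y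
   built on the separating family contains no l_1, and K embeds in the dual of
   Y by evaluation. *)
Require Import Defs.
From HB Require Import structures.
From mathcomp Require Import all_boot all_order all_algebra.
From mathcomp Require Import all_classical all_reals all_analysis.
From mathcomp Require Import ring lra.
Set Implicit Arguments. Unset Strict Implicit. Unset Printing Implicit Defensive.
Import Order.TTheory GRing.Theory Num.Theory.
Import numFieldNormedType.Exports.
Local Open Scope classical_set_scope.
Local Open Scope ring_scope.

(** * Means, ultrafilters and null sets *)

(** Absence of independent sequences is a combinatorial condition with no evident stability under
    sums and uniform limits, whereas total boundedness for a seminorm has it; hence the detour
    through [L_1]. No single probability suffices: the one separating a given copy of [l_1] is built
    from that copy, so all sequences of means are quantified over. The limit along the ultrafilter
    is never formed; inequalities hold for almost every index, and neither measurability nor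
    countable additivity enters. The link with independence is a dichotomy: either the whole space
    can be split forever, which yields an independent sequence, or two limit charges are mutually
    singular, which contradicts separation in [L_1]. *)

Section Ultrafilters.
Variables (T : Type) (V : set_system T).
Hypothesis VU : UltraFilter V.

Lemma ultraN (D : set T) : ~ V D -> V (~` D).
Proof. by case: (in_ultra_setVsetC D VU). Qed.

Lemma ultra_bigor (I : eqType) (s : seq I) (D : I -> set T) :
  V [set t | exists2 i, i \in s & D i t] -> exists2 i, i \in s & V (D i).
Proof.
elim: s => [|i s IHs] VD.
  by have [t [j]] := @filter_ex _ V _ _ VD; rewrite in_nil.
have [VDi|/ultraN VDi] := pselect (V (D i)).
  by exists i => //; rewrite inE eqxx.
have [|j js VDj] := IHs; last by exists j => //; rewrite inE js orbT.
apply: filterS2 VD VDi => t [j]; rewrite inE => /orP[/eqP->//|js Dj _].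
by exists j.
Qed.

End Ultrafilters.

Section Means.
Context {R : realType} {P : Type}.

(** A mean acts on all functions, so that no integrability has to be tracked; those built below are
    averages over finite lists of points. *)
Definition is_mean (mu : (P -> R) -> R) : Prop :=
  [/\ forall f g, mu (fun x => f x + g x) = mu f + mu g,
      forall c f, mu (fun x => c * f x) = c * mu f,
      forall f g, (forall x, f x <= g x) -> mu f <= mu g &
      mu (fun=> 1) = 1].

Definition charge_of (mu : (P -> R) -> R) (E : set P) : R := mu (\1_E).

Variable mu : (P -> R) -> R.
Hypothesis mu_mean : is_mean mu.

Lemma mean_cst c : mu (fun=> c) = c.
Proof.
have [_ hZ _ h1] := mu_mean.
by rewrite -[RHS]mulr1 -h1 -hZ; congr mu; apply/funext => x; rewrite mulr1.
Qed.

Lemma mean_sum (J : Type) (s : seq J) (F : J -> P -> R) :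
  mu (fun x => \sum_(j <- s) F j x) = \sum_(j <- s) mu (F j).
Proof.
have [hD _ _ _] := mu_mean; elim: s => [|j s IHs].
  rewrite big_nil -[RHS](mean_cst 0); congr mu; apply/funext => x.
  by rewrite big_nil.
rewrite big_cons -IHs -hD; congr mu; apply/funext => x.
by rewrite big_cons.
Qed.

Lemma charge_ofT : charge_of mu setT = 1.
Proof. by rewrite /charge_of indicT; case: mu_mean. Qed.

Lemma charge_of0 : charge_of mu set0 = 0.
Proof. by rewrite /charge_of indic0; exact: mean_cst. Qed.

Lemma charge_of_le (E F : set P) : E `<=` F -> charge_of mu E <= charge_of mu F.
Proof.
have [_ _ hle _] := mu_mean => EF; apply: hle => x.
rewrite !indicE ler_nat; case: (boolP (x \in E)) => //= /set_mem/EF/mem_set->.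
by [].
Qed.

Lemma charge_of_le1 (E : set P) : charge_of mu E <= 1.
Proof. by rewrite -charge_ofT; exact: charge_of_le. Qed.

Lemma charge_ofU (E F : set P) : [disjoint E & F] ->
  charge_of mu (E `|` F) = charge_of mu E + charge_of mu F.
Proof.
have [hD _ _ _] := mu_mean => /disj_set2P EF.
rewrite /charge_of -hD; congr mu; apply/funext => x.
rewrite !indicE in_setU -natrD; congr _%:R.
case: (boolP (x \in E)) => [/set_mem Ex|_] /=; last by rewrite add0n.
case: (boolP (x \in F)) => // /set_mem Fx.
by have : (E `&` F) x by []; rewrite EF.
Qed.

Lemma charge_of_leU (E F G : set P) : G `<=` E `|` F ->
  charge_of mu G <= charge_of mu E + charge_of mu F.
Proof.
have [hD _ hle _] := mu_mean => GEF.
rewrite /charge_of -hD; apply: hle => x.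
rewrite !indicE -natrD ler_nat.
case: (boolP (x \in G)) => // /set_mem/GEF[]/mem_set-> //.
by rewrite addnC.
Qed.

End Means.

Section NullSets.
Context {R : realType} {P T : Type}.
Variables (U : set_system nat) (V : set_system T).
Hypotheses (UU : UltraFilter U) (VU : UltraFilter V).
Variable mu : nat -> (P -> R) -> R.
Hypothesis mu_mean : forall n, is_mean (mu n).

Definition limit_small (e : R) (G : T -> set P) : Prop :=
  V [set t | U [set n | charge_of (mu n) (G t) < e]].

Lemma limit_smallN e G : ~ limit_small e G ->
  V [set t | U [set n | e <= charge_of (mu n) (G t)]].
Proof.
move=> /(ultraN VU); apply: filterS => t /= /(ultraN UU).
by apply: filterS => n /negP; rewrite -leNgt.
Qed.

Lemma limit_smallD e1 e2 (G H K : T -> set P) :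
  (forall t, G t `<=` H t `|` K t) ->
  limit_small e1 H -> limit_small e2 K -> limit_small (e1 + e2) G.
Proof.
move=> GHK; apply: filterS2 => t /=; apply: filterS2 => n /= h1 h2.
by apply: le_lt_trans (ltrD h1 h2); apply: charge_of_leU.
Qed.

Lemma limit_smallS e (G H : T -> set P) : (forall t, G t `<=` H t) ->
  limit_small e H -> limit_small e G.
Proof.
move=> GH; apply: filterS => t /=; apply: filterS => n /=.
by apply: le_lt_trans; apply: charge_of_le.
Qed.

Lemma limit_small0 e : 0 < e -> limit_small e (fun=> set0).
Proof.
by move=> e0; near=> t; near=> n; rewrite /= charge_of0.
Unshelve. all: by end_near. Qed.

(* The two limit charges [lim_t mu (_ `&` A t)] and [lim_t mu (_ `&` B t)] are
   mutually singular on [E]. *)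
Definition singular_on (A B : T -> set P) (E : set P) : Prop :=
  forall e : R, 0 < e -> exists F : set P,
    limit_small e (fun t => E `&` F `&` A t) /\
    limit_small e (fun t => (E `\` F) `&` B t).

Lemma singular_onC A B E : singular_on A B E -> singular_on B A E.
Proof.
move=> h e e0; have [F [h1 h2]] := h e e0; exists (~` F).
split; [apply: limit_smallS h2|apply: limit_smallS h1] => t;
by rewrite !setDE ?setCK.
Qed.

Fixpoint cover (A : T -> set P) (s : seq T) : set P :=
  if s is t :: s' then A t `|` cover A s' else set0.

(** The separating sets of the pieces are glued by letting the first listed [A t] that contains a
    point decide. *)
Lemma singular_cover (A B : T -> set P) (E : set P) (D : set T) (s : seq T) :
  (forall t, D t -> singular_on A B (E `&` A t)) ->
  (forall i t0, (i < size s)%N -> D (nth t0 s i)) ->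
  singular_on A B (E `&` cover A s).
Proof.
move=> hD; elim: s => [|t s IHs] hs e e0.
  exists set0; split; apply: limit_smallS (limit_small0 e0) => t;
  by rewrite /= !(setI0, set0I, set0D).
have e20 : 0 < e / 2 by rewrite divr_gt0.
have [F [F1 F2]] := hD t (hs 0%N t isT) _ e20.
have [G [G1 G2]] := IHs (fun i t0 => hs i.+1 t0) _ e20.
exists ((A t `&` F) `|` (~` A t `&` G)); rewrite (splitr e).
split.
  apply: limit_smallD F1 G1 => u x; rewrite /=.
  by have [Ax|Ax] := pselect (A t x); [left|right]; tauto.
apply: limit_smallD F2 G2 => u x; rewrite /setD /=.
by have [Ax|Ax] := pselect (A t x); [left|right]; tauto.
Qed.

(** Otherwise each finite cover could be enlarged by a disjoint piece of charge at least [e], and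
    after more than [1 / e] steps the total charge would exceed 1. *)
Lemma cover_exhausts (A : T -> set P) (E : set P) (D : set T) (e : R) :
  V D -> 0 < e -> exists s : seq T,
    (forall i t0, (i < size s)%N -> D (nth t0 s i)) /\
    limit_small e (fun t => (E `\` cover A s) `&` A t).
Proof.
move=> VD e0; apply: contrapT => hN.
have [N eN] : exists N : nat, 1 < N%:R * e.
  exists (Num.truncn (1 / e)).+1; rewrite -ltr_pdivrMr //.
  exact: truncnS_gt.
suff [s [_ hs]] : exists s : seq T,
    (forall i t0, (i < size s)%N -> D (nth t0 s i)) /\
    U [set n | N%:R * e <= charge_of (mu n) (E `&` cover A s)].
  have [n /= hn] := @filter_ex _ U _ _ hs.
  have := le_lt_trans hn (le_lt_trans (charge_of_le1 (mu_mean n) _) eN).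
  by rewrite ltxx.
elim: N {eN} => [|N [s [sD hs]]].
  exists [::]; split=> //; near=> n => /=; rewrite mul0r.
  by rewrite /= setI0 charge_of0.
have /limit_smallN : ~ limit_small e (fun t => (E `\` cover A s) `&` A t).
  by move=> h; apply: hN; exists s.
move=> /(filterI VD) /(@filter_ex _ V)[t [Dt /= ht]].
exists (t :: s); split; first by case=> [|i] t0 //= ?; exact: sD.
apply: filterS2 hs ht => n /= h1 h2.
rewrite -natr1 mulrDl mul1r; apply: le_trans (lerD h1 h2) _.
rewrite -charge_ofU //; last first.
  by apply/disj_set2P/seteqP; split => x // [[? ?] [[? ?] ?]].
by apply: charge_of_le => // x [|]; rewrite /setD /=; tauto.
Unshelve. all: by end_near. Qed.

Lemma singular_step (A B : T -> set P) (E : set P) (D : set T) :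
  V D -> (forall t, D t -> singular_on A B (E `&` A t)) -> singular_on A B E.
Proof.
move=> VD hD e e0; have e20 : 0 < e / 2 by rewrite divr_gt0.
have [s [sD hs]] := cover_exhausts A E VD e20.
have [F [F1 F2]] := singular_cover hD sD e20.
(* Off the cover the traces of [A t] are already small, so the whole remainder goes to the side that
   only has to be small for [A]. *)
exists ((cover A s `&` F) `|` ~` cover A s); rewrite (splitr e); split.
  by apply: limit_smallD F1 hs => t x /=; rewrite /setD /=; tauto.
apply: limit_smallD F2 (limit_small0 e20) => t x /=; rewrite /setD /=.
by have [?|?] := pselect (cover A s x); tauto.
Qed.

(* On a set that is not null, both [A t] and [B t] leave traces that are not
   null for almost every [t], so that it can be split forever, whereas null sets
   are singular by induction. *)
Inductive null (A B : T -> set P) : set P -> Prop :=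
| null_empty : null A B set0
| null_left E D : V D -> (forall t, D t -> null A B (E `&` A t)) -> null A B E
| null_right E D : V D -> (forall t, D t -> null A B (E `&` B t)) -> null A B E.

Lemma null_singular A B E : null A B E -> singular_on A B E.
Proof.
elim=> {E} [e e0|E D VD _ IH|E D VD _ IH].
- exists set0; split; apply: limit_smallS (limit_small0 e0) => t;
  by rewrite !(setI0, set0I, set0D).
- exact: singular_step VD IH.
- apply: singular_onC; apply: singular_step VD _ => t Dt.
  exact/singular_onC/IH.
Qed.

(** All the intersections of [E] with one of [A t], [B t] for each [t] in [s] are not null, hence
    nonempty. *)
Fixpoint splits_by (A B : T -> set P) (E : set P) (s : seq T) : Prop :=
  if s is t :: s' then splits_by A B (E `&` A t) s' /\ splits_by A B (E `&` B t) s'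
  else ~ null A B E.

Lemma splits_by_extend A B E s : splits_by A B E s ->
  V [set t | splits_by A B E (rcons s t)].
Proof.
elim: s E => [|t s IHs] E /=; last first.
  by move=> [/IHs h1 /IHs h2]; apply: filterS2 h1 h2.
move=> nE.
have h1 : V (~` [set t | null A B (E `&` A t)]).
  by apply: ultraN => // h; apply: nE; apply: null_left h _.
have h2 : V (~` [set t | null A B (E `&` B t)]).
  by apply: ultraN => // h; apply: nE; apply: null_right h _.
by apply: filterS2 h1 h2.
Qed.

Lemma splits_by_nonempty A B E s t0 (eps : nat -> bool) :
  splits_by A B E s ->
  exists x, E x /\ forall i, (i < size s)%N ->
    (if eps i then B (nth t0 s i) else A (nth t0 s i)) x.
Proof.
elim: s E eps => [|t s IHs] E eps /=.
  move=> nE; have [[x Ex]|hE] := pselect (exists x, E x); first by exists x.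
  case: nE; suff -> : E = set0 by exact: null_empty.
  by apply/seteqP; split => x // Ex; case: hE; exists x.
move=> [hA hB]; case eps0 : (eps 0%N).
  have [x [[Ex Bx] hx]] := IHs _ (eps \o succn) hB.
  by exists x; split => // -[_|i /hx//]; rewrite /= eps0.
have [x [[Ex Bx] hx]] := IHs _ (eps \o succn) hA.
by exists x; split => // -[_|i /hx//]; rewrite /= eps0.
Qed.

(** Dependent choice along the tree: almost every [t] splits all its finitely many leaves at
    once. *)
Lemma nonnull_independent A B (D : set T) : V D -> ~ null A B setT ->
  exists t : nat -> T, (forall n, D (t n)) /\
    forall (m : nat) (eps : nat -> bool), exists x, forall i, (i < m)%N ->
      (if eps i then B (t i) else A (t i)) x.
Proof.
move=> VD nT.
have step (s : {s : seq T | splits_by A B setT s}) :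
    {t : T | D t /\ splits_by A B setT (rcons (sval s) t)}.
  apply: cid.
  have [t [Dt ht]] := filter_ex (filterI VD (splits_by_extend (svalP s))).
  by exists t.
pose next s : {s : seq T | splits_by A B setT s} :=
  exist _ (rcons (sval s) (sval (step s))) (svalP (step s)).2.
pose st := fix st n := if n is n'.+1 then next (st n') else exist _ [::] nT.
exists (fun n => sval (step (st n))); split.
  by move=> n; exact: (svalP (step (st n))).1.
move=> m eps.
have size_st n : size (sval (st n)) = n.
  by elim: n => //= n IHn; rewrite size_rcons IHn.
have nth_st t0 n i : (i < n)%N -> nth t0 (sval (st n)) i = sval (step (st i)).
  elim: n => //= n IHn; rewrite ltnS nth_rcons size_st => ilen.
  case: ltnP => [/IHn//|nlei]; rewrite (_ : i = n) ?eqxx //.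
  by apply/eqP; rewrite eqn_leq ilen.
have t0 := sval (step (st 0%N)).
have [x [_ hx]] := splits_by_nonempty t0 eps (svalP (st m)).
by exists x => i im; have := hx i; rewrite size_st nth_st // => /(_ im).
Qed.

End NullSets.

(** * Total boundedness and independent sequences *)

Section TotalBoundedness.
Context {R : realType} {P : Type}.

Definition bounded_by1 (G : set (P -> R)) : Prop :=
  forall g, G g -> forall x, `|g x| <= 1.

Definition independent_in (G : set (P -> R)) (p q : R) : Prop :=
  exists g : nat -> P -> R, (forall n, G (g n)) /\
    forall (m : nat) (eps : nat -> bool), exists x, forall i, (i < m)%N ->
      if eps i then q <= g i x else g i x <= p.

Variables (U : set_system nat) (mu : nat -> (P -> R) -> R).
Hypotheses (UU : UltraFilter U) (mu_mean : forall n, is_mean (mu n)).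

Definition limit_close (e : R) (g h : P -> R) : Prop :=
  U [set n | mu n (fun x => `|g x - h x|) < e].

(** The centres are bounded but need not lie in [G], so that sums and multiples of centres may serve
    for another set. *)
Definition mean_tb (G : set (P -> R)) : Prop :=
  forall e : R, 0 < e -> exists (N : nat) (l : nat -> P -> R),
    (forall i, exists B, forall x, `|l i x| <= B) /\
    forall g, G g -> exists2 i, (i < N)%N & limit_close e g (l i).

(** The sets of members of [G] far from a finite list of bounded functions form a filter base, which
    is proper as no finite list is an [e]-net. *)
Lemma separated_ultrafilter (G : set (P -> R)) (e : R) :
  (forall (N : nat) (l : nat -> P -> R),
     (forall i, exists B, forall x, `|l i x| <= B) -> exists2 g, G g &
     forall i, (i < N)%N -> ~ limit_close e g (l i)) ->
  exists V : set_system (P -> R), [/\ UltraFilter V, V G &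
    forall h B, (forall x, `|h x| <= B) -> V [set g | ~ limit_close e g h]].
Proof.
move=> hG.
pose Far (Nl : nat * (nat -> P -> R)) : set (P -> R) := [set g | G g /\
  forall i, (i < Nl.1)%N -> ~ limit_close e g (Nl.2 i)].
pose Bd (Nl : nat * (nat -> P -> R)) := forall i, exists B, forall x, `|Nl.2 i x| <= B.
have Bd0 : Bd (0%N, fun _ _ => 0) by exists 0 => x; rewrite normr0.
have FF : Filter (filter_from Bd Far).
  apply: filter_from_filter; first by exists (0%N, fun _ _ => 0).
  move=> [N l] [N' l'] lB lB'.
  exists ((N + N')%N, fun i => if (i < N)%N then l i else l' (i - N)%N) => //.
    by move=> i /=; case: ifP.
  move=> g [Gg hg]; split; split=> //= i iN.
    by have := hg i; rewrite /= iN; apply; exact: ltn_addr.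
  by have := hg (N + i)%N; rewrite /= ltn_add2l (ltnNge (N + i)) leq_addr addKn; exact.
have PF : ProperFilter (filter_from Bd Far).
  apply: filter_from_proper => // -[N l] lB.
  by have [g Gg hg] := hG N l lB; exists g.
have [V [VU FV]] := ultraFilterLemma PF.
exists V; split => //.
  by apply: FV; exists (0%N, fun _ _ => 0) => // g [].
move=> h B hB; apply: FV; exists (1%N, fun _ => h); first by exists B.
by move=> g [_ /(_ 0%N isT)].
Qed.

Definition level (e : R) (j : nat) : R := j%:R * e - 1.

(** An interval of length [2 * e] contains a full cell of the grid of mesh [e] that starts at -1. *)
Lemma level_between (e a b : R) (J : nat) : 0 < e -> 2 <= J%:R * e ->
  -1 <= a -> b <= 1 -> a + 2 * e <= b ->
  exists2 j, (j < J)%N & a <= level e j /\ level e j.+1 <= b.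
Proof.
move=> e0 Je a1 b1 ab; pose t := (a + 1) / e.
have t0 : 0 <= t by rewrite divr_ge0 ?(ltW e0)// -lerBlDr sub0r.
have te : t * e = a + 1 by rewrite divfK// gt_eqF.
have /andP[h1 h2] := truncn_itv t0.
pose j := (Num.truncn t).+1.
have aj : a <= level e j.
  by rewrite /level lerBrDr -te ler_pM2r// ltW.
have jb : level e j.+1 <= b.
  apply: le_trans ab; rewrite /level /j -2!natr1 2!mulrDl mul1r.
  have : (Num.truncn t)%:R * e <= t * e by rewrite ler_pM2r.
  by rewrite te; lra.
exists j => //; rewrite -(ler_nat R) -(ler_pM2r e0); apply: le_trans Je.
have := le_trans jb b1; rewrite /level; lra.
Qed.

Definition gap_set (e : R) (J : nat) (i : bool * 'I_J) (g h : P -> R) : set P :=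
  if i.1 then [set x | g x <= level e i.2 /\ level e i.2.+1 <= h x]
  else [set x | h x <= level e i.2 /\ level e i.2.+1 <= g x].

(** Off the [2 * J] gap sets the difference is below [2 * e], and it never exceeds 2; were all their
    charges below [e / (4 * J)], the mean would be at most [3 * e]. *)
Lemma gap_set_charge (e : R) (J : nat) (g h : P -> R) n :
  0 < e -> (0 < J)%N -> 2 <= J%:R * e ->
  (forall x, `|g x| <= 1) -> (forall x, `|h x| <= 1) ->
  4 * e <= mu n (fun x => `|g x - h x|) ->
  exists2 i : bool * 'I_J, i \in enum {: bool * 'I_J} &
    e / (4 * J%:R) <= charge_of (mu n) (gap_set e i g h).
Proof.
move=> e0 J0 Je hg hh he; have [hD hZ hle _] := mu_mean n.
apply: contrapT => hN.
have hlt (i : bool * 'I_J) : charge_of (mu n) (gap_set e i g h) <= e / (4 * J%:R).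
  apply: ltW; rewrite ltNge; apply/negP => hi; apply: hN.
  by exists i; rewrite ?mem_enum.
suff : mu n (fun x => `|g x - h x|) <= 2 * e + 2 * (e / 2).
  by move=> /(le_trans he); lra.
have -> : e / 2 = \sum_(i : bool * 'I_J) (e / (4 * J%:R)).
  rewrite sumr_const card_prod card_bool card_ord -[RHS]mulr_natr natrM.
  by field; rewrite pnatr_eq0 -lt0n.
have : mu n (fun x => `|g x - h x|) <=
   2 * e + 2 * \sum_(i : bool * 'I_J) charge_of (mu n) (gap_set e i g h).
  rewrite -(mean_cst (mu_mean n) (2 * e)).
  rewrite -(mean_sum (mu_mean n) _ (fun i => \1_(gap_set e i g h))).
  rewrite -hZ -hD; apply: hle => x.
  have S0 (i : bool * 'I_J) : 0 <= \1_(gap_set e i g h) x :> R by rewrite indicE.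
  have [/ltW|gap] := ltP `|g x - h x| (2 * e).
    by move=> h1; apply: (le_trans h1); rewrite lerDl mulr_ge0 ?sumr_ge0.
  have [i hi] : exists i : bool * 'I_J, gap_set e i g h x.
    have := hg x; have := hh x; rewrite !ler_norml => /andP[h1 h2] /andP[g1 g2].
    have [gh|gh] := lerP (g x) (h x).
      have [j jJ [? ?]] : exists2 j, (j < J)%N &
          g x <= level e j /\ level e j.+1 <= h x.
        apply: level_between => //.
        by move: gap; rewrite distrC ger0_norm ?subr_ge0//; lra.
      by exists (true, Ordinal jJ).
    have [j jJ [? ?]] : exists2 j, (j < J)%N &
        h x <= level e j /\ level e j.+1 <= g x.
      apply: level_between => //.
      by move: gap; rewrite ger0_norm ?subr_ge0 ?(ltW gh)//; lra.
    by exists (false, Ordinal jJ).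
  rewrite (bigD1 i) //= [X in X + \sum_(_ | _) _]indicE mem_set //=.
  have : 0 <= \sum_(j | j != i) \1_(gap_set e j g h) x :> R by exact: sumr_ge0.
  have : `|g x - h x| <= 2.
    by apply: le_trans (ler_normB _ _) _; have := hg x; have := hh x; lra.
  lra.
move=> /le_trans; apply; rewrite lerD2l ler_pM2l//.
by apply: ler_sum => i _; exact: hlt.
Qed.

Lemma mean_tbN_independent (G : set (P -> R)) :
  bounded_by1 G -> ~ mean_tb G ->
  exists p q : R, p < q /\ independent_in G p q.
Proof.
move=> G1 ntb.
have [e e0 he] : exists2 e : R, 0 < e &
    forall (N : nat) (l : nat -> P -> R),
      (forall i, exists B, forall x, `|l i x| <= B) -> exists2 g, G g &
      forall i, (i < N)%N -> ~ limit_close (4 * e) g (l i).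
  apply: contrapT => hN; apply: ntb => e e0.
  apply: contrapT => hl; apply: hN; exists (e / 4); first by rewrite divr_gt0.
  move=> N l lB; apply: contrapT => hg; apply: hl; exists N, l; split=> // g Gg.
  apply: contrapT => hi; apply: hg; exists g => // i iN close; apply: hi.
  by exists i => //; move: close; rewrite mulrC divfK// pnatr_eq0.
have [V [VU VG Vsep]] := separated_ultrafilter he.
have [J Je] : exists J : nat, 2 <= J%:R * e.
  exists (Num.truncn (2 / e)).+1; rewrite -ler_pdivrMr //.
  by apply: ltW; exact: truncnS_gt.
have J0 : (0 < J)%N.
  by rewrite lt0n; apply/eqP => J0; move: Je; rewrite J0 mul0r; lra.
pose th := e / (4 * J%:R).
have th0 : 0 < th by rewrite divr_gt0 ?mulr_gt0 ?ltr0n.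
(* Three nested pigeonholes, over [n], [g] and [h], make the gap independent of all of them. *)
have [i _ hi] : exists2 i : bool * 'I_J, i \in enum {: bool * 'I_J} &
    V [set h | V [set g | U [set n |
      th <= charge_of (mu n) (gap_set e i g h)]]].
  apply: ultra_bigor; apply: filterS (VG) => h Gh.
  apply: ultra_bigor; apply: filterS2 (VG) (Vsep h _ (G1 h Gh)) => g Gg.
  move=> /(ultraN UU) hn; apply: ultra_bigor; apply: filterS hn => n /negP.
  by rewrite -leNgt; apply: gap_set_charge => //; exact: G1.
pose A (g : P -> R) := [set x | g x <= level e i.2].
pose B (g : P -> R) := [set x | level e i.2.+1 <= g x].
exists (level e i.2), (level e i.2.+1); split.
  by rewrite /level -natr1; lra.
have [nT|nT] := pselect (null V A B setT); last first.
  have [g [Gg hg]] := nonnull_independent VU VG nT.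
  exists g; split => // m eps.
  by have [x hx] := hg m eps; exists x => k /hx; case: (eps k).
have th20 : 0 < th / 2 by rewrite divr_gt0.
have [F [F1 F2]] := null_singular UU VU mu_mean nT th20.
(* The set [F] covers [A g] meet [B h] by two parts of charge below [th / 2]. *)
have absurd g h n :
    charge_of (mu n) ([set: P] `&` F `&` A g) < th / 2 ->
    charge_of (mu n) ((setT `\` F) `&` B h) < th / 2 ->
    th <= charge_of (mu n) (A g `&` B h) -> False.
  move=> h1 h2; apply/negP; rewrite -ltNge (splitr th).
  apply: le_lt_trans (ltrD h1 h2); apply: charge_of_leU => // x [Ax Bx].
  by have [Fx|Fx] := pselect (F x); [left|right].
(* Iterated ultrafilter quantifiers do not commute: [h] is chosen before [g], and the orientation of
   the gap decides which of them plays [A] and which plays [B]. *)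
exfalso; rewrite /gap_set in hi; case: (i.1) hi => hi.
  have [h [h1 h2]] := filter_ex (filterI hi F2).
  have [g [g1 g2]] := filter_ex (filterI h1 F1).
  have [n [n1 [n2 n3]]] := filter_ex (filterI g1 (filterI g2 h2)).
  exact: absurd n2 n3 n1.
have [h [h1 h2]] := filter_ex (filterI hi F1).
have [g [g1 g2]] := filter_ex (filterI h1 F2).
have [n [n1 [n2 n3]]] := filter_ex (filterI g1 (filterI h2 g2)).
exact: absurd n2 n3 n1.
Qed.

End TotalBoundedness.

(** * Sequences dominating l_1 in the supremum norm *)

Section EllOneFree.
Context {R : realType} {P : Type}.

(* Potential argument: the sum of the squared positive parts of the deficits
   grows at most linearly along the greedily chosen points, since the point
   chosen for the current positive parts makes the cross term nonpositive. *)
Lemma greedy_minimax (Q : finType) (F : Q -> P -> R) (D e : R) : 0 < e ->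
  (forall q x, `|F q x| <= D) ->
  (forall c : Q -> R, (forall q, 0 <= c q) ->
    exists x, 0 <= \sum_q c q * F q x) ->
  exists s : seq P, (0 < size s)%N /\
    forall q, - e * (size s)%:R <= \sum_(x <- s) F q x.
Proof.
move=> e0 FD hF.
pose dplus (s : seq P) q := Num.max 0 (- \sum_(x <- s) F q x).
have growth n : exists s : seq P, size s = n /\
    \sum_q (dplus s q) ^+ 2 <= n%:R * (#|Q|%:R * D ^+ 2).
  elim: n => [|n [s [sn hs]]].
    exists [::]; split=> //; rewrite mul0r big1// => q _.
    by rewrite /dplus big_nil oppr0 maxxx expr0n.
  have [x hx] := hF (dplus s) (fun q => ltac:(by rewrite le_max lexx)).
  exists (x :: s); split; first by rewrite /= sn.
  apply: (@le_trans _ _ (\sum_q ((dplus s q) ^+ 2 - 2 * (dplus s q * F q x)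
      + D ^+ 2))); last first.
    rewrite big_split/= sumr_const sumrB -mulr_sumr -natr1 mulrDl mul1r.
    by rewrite -[D ^+ 2 *+ _]mulr_natl; lra.
  apply: ler_sum => q _; rewrite {1}/dplus big_cons opprD.
  set d := - \sum_(y <- s) F q y.
  have FqD : F q x ^+ 2 <= D ^+ 2.
    by rewrite -real_normK ?num_real// lerXn2r ?nnegrE// (le_trans _ (FD q x)).
  have -> : dplus s q = Num.max 0 d by [].
  have [?|?] := lerP 0 (- F q x + d); have [?|?] := lerP 0 d; nra.
have [n [n0 hn]] : exists n : nat, (0 < n)%N /\ #|Q|%:R * D ^+ 2 <= n%:R * e ^+ 2.
  exists (Num.truncn (#|Q|%:R * D ^+ 2 / e ^+ 2)).+1; split => //.
  rewrite -ler_pdivrMr ?exprn_gt0//; apply: ltW; exact: truncnS_gt.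
have [s [sn hs]] := growth n; exists s; split; first by rewrite sn.
move=> q; rewrite sn mulNr lerNl.
apply: (@le_trans _ _ (dplus s q)); first by rewrite le_max lexx orbT.
rewrite -(@ler_pXn2r _ 2%N)// ?nnegrE ?mulr_ge0 ?(ltW e0)// ?le_max ?lexx//.
apply: le_trans (_ : \sum_q dplus s q ^+ 2 <= _).
  rewrite (bigD1 q)//= lerDl sumr_ge0// => *; exact: sqr_ge0.
apply: le_trans hs _; apply: le_trans (ler_wpM2l (ler0n _ n) hn) _.
by rewrite exprMn mulrA (mulrC (e ^+ 2)) expr2.
Qed.

(** Greedy cut: each new vertex joins the side that cuts at least half of its weight towards the
    earlier ones. *)
Lemma max_cut (c : nat -> nat -> R) (n : nat) : (forall i j, 0 <= c i j) ->
  exists eps : nat -> bool,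
    \sum_(i < n) \sum_(j < n) (i != j :> nat)%:R * c i j <=
    2 * \sum_(i < n) \sum_(j < n) (eps i != eps j)%:R * c i j.
Proof.
move=> c0; elim: n => [|n [eps heps]].
  by exists (fun=> true); rewrite !big_ord0 mulr0.
pose wt b := \sum_(i < n) (eps i != b)%:R * (c i n + c n i).
have [b hb] : exists b, \sum_(i < n) (c i n + c n i) <= 2 * wt b.
  have : \sum_(i < n) (c i n + c n i) = wt true + wt false.
    rewrite -big_split; apply: eq_bigr => i _ /=.
    by case: (eps i); rewrite /= ?mul1r ?mul0r ?add0r ?addr0.
  move=> ->; have [?|?] := lerP (wt true) (wt false).
    by exists false; lra.
  by exists true; lra.
have split_sum (f : nat -> nat -> R) : \sum_(i < n.+1) \sum_(j < n.+1) f i j =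
    \sum_(i < n) \sum_(j < n) f i j + \sum_(i < n) (f i n + f n i) + f n n.
  rewrite big_ord_recr/= big_ord_recr/= big_split/=.
  under eq_bigr do rewrite big_ord_recr/=.
  by rewrite big_split/= !addrA.
exists (fun i => if (i < n)%N then eps i else b).
rewrite (split_sum (fun i j => (i != j)%:R * c i j)).
rewrite (split_sum (fun i j => ((if (i < n)%N then eps i else b) !=
   (if (j < n)%N then eps j else b))%:R * c i j)) /=.
rewrite ltnn !eqxx !mul0r !addr0 mulrDr; apply: lerD.
  apply: le_trans heps _; rewrite ler_pM2l//; apply: ler_sum => i _.
  by apply: ler_sum => j _; rewrite !ltn_ord.
under eq_bigr => i _ do
  rewrite (ltn_eqF (ltn_ord i)) (gtn_eqF (ltn_ord i)) /= !mul1r.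
apply: le_trans hb _; rewrite ler_pM2l//; apply: ler_sum => i _.
by rewrite ltn_ord (eq_sym b) mulrDr.
Qed.

(** By [greedy_minimax] with error [d / 2], it suffices to find, for any weights on the pairs, one
    point where the weighted average of the distances is at least [d]; the weights are turned into
    coefficients of an [l_1] combination by a cut. *)
Lemma l1_seq_separated (w : nat -> P -> R) (d B : R) (n : nat) : 0 < d ->
  (forall k x, `|w k x| <= B) ->
  (forall (m : nat) (a : nat -> R), exists x,
    d * \sum_(k < m) `|a k| <= `|\sum_(k < m) a k * w k x|) ->
  exists s : seq P, (0 < size s)%N /\
    forall k l, (k < n)%N -> (l < n)%N -> k != l ->
      d / 2 * (size s)%:R <= \sum_(x <- s) `|w k x - w l x|.
Proof.
move=> d0 wB hw.
pose F (q : 'I_n * 'I_n) x : R :=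
  (q.1 != q.2 :> nat)%:R * (`|w q.1 x - w q.2 x| - d).
have FD q x : `|F q x| <= 2 * B + d.
  rewrite normrM.
  have h1 : `|(q.1 != q.2 :> nat)%:R : R| <= 1 by case: (_ != _); rewrite ?normr1 ?normr0.
  have h2 : `| `|w q.1 x - w q.2 x| - d| <= 2 * B + d.
    apply: le_trans (ler_normB _ _) _; rewrite normr_id (gtr0_norm d0) lerD2r.
    by apply: le_trans (ler_normB _ _) _; have := wB q.1 x; have := wB q.2 x; lra.
  by rewrite -[leRHS]mul1r; apply: ler_pM.
have hF (c : 'I_n * 'I_n -> R) : (forall q, 0 <= c q) ->
    exists x, 0 <= \sum_q c q * F q x.
  move=> c0.
  pose c' (i j : nat) : R := if (insub i : option 'I_n, insub j : option 'I_n)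
    is (Some i', Some j') then c (i', j') else 0.
  have c'E (i j : 'I_n) : c' i j = c (i, j) by rewrite /c' !valK.
  have c'0 i j : 0 <= c' i j by rewrite /c'; case: (insub i) (insub j) => [?|] [?|].
  have [eps heps] := max_cut n c'0.
  (* Only cut pairs contribute to [a]. Within [a i] all terms have the sign of the side of [i], so
     that nothing cancels and the absolute values sum to twice the weight of the cut. *)
  pose sg i j : R := (eps i)%:R - (eps j)%:R.
  pose a i := \sum_(j < n) (c' i j + c' j i) * sg i j.
  have [x hx] := hw n a; exists x.
  have aE : \sum_(i < n) a i * w i x =
      \sum_(i < n) \sum_(j < n) c' i j * (sg i j * (w i x - w j x)).
    transitivity (\sum_(i < n) \sum_(j < n) c' i j * (sg i j * w i x) +
        \sum_(i < n) \sum_(j < n) c' j i * (sg i j * w i x)).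
      rewrite -big_split; apply: eq_bigr => i _ /=.
      by rewrite -big_split mulr_suml; apply: eq_bigr => j _ /=; ring.
    rewrite [X in _ + X]exchange_big -big_split; apply: eq_bigr => i _ /=.
    by rewrite -big_split; apply: eq_bigr => j _; rewrite /sg /=; ring.
  have up : `|\sum_(i < n) a i * w i x| <=
      \sum_(i < n) \sum_(j < n) (i != j :> nat)%:R * (c' i j * `|w i x - w j x|).
    rewrite aE; apply: le_trans (ler_norm_sum _ _ _) _; apply: ler_sum => i _.
    apply: le_trans (ler_norm_sum _ _ _) _; apply: ler_sum => j _.
    rewrite normrM (ger0_norm (c'0 _ _)) normrM.
    have [->|ij] := eqVneq (i : nat) (j : nat).
      by rewrite /sg subrr normr0 !mul0r mulr0.
    rewrite mul1r ler_wpM2l// -[leRHS]mul1r ler_wpM2r//.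
    by rewrite /sg; case: (eps i) (eps j) => [] [];
      rewrite ?subrr ?subr0 ?sub0r ?normrN ?normr1 ?normr0.
  have low : \sum_(i < n) \sum_(j < n) (i != j :> nat)%:R * c' i j <=
      \sum_(i < n) `|a i|.
    apply: le_trans heps _.
    pose sw i : R := if eps i then 1 else -1.
    have sgE i j : sw i * sg i j = (eps i != eps j)%:R.
      by rewrite /sw /sg; case: (eps i) (eps j) => [] []; rewrite /=; lra.
    apply: (@le_trans _ _ (\sum_(i < n) sw i * a i)); last first.
      apply: ler_sum => i _; apply: le_trans (ler_norm _) _; rewrite normrM.
      by rewrite /sw; case: (eps i); rewrite ?normrN normr1 mul1r.
    rewrite le_eqVlt; apply/orP; left; apply/eqP.
    transitivity (\sum_(i < n) \sum_(j < n) (eps i != eps j)%:R * c' i j +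
      \sum_(i < n) \sum_(j < n) (eps i != eps j)%:R * c' j i).
      rewrite [X in _ + X]exchange_big /=.
      under [X in _ + X]eq_bigr do under eq_bigr do rewrite eq_sym.
      by rewrite mulr_natl mulr2n.
    rewrite -big_split; apply: eq_bigr => i _ /=.
    rewrite -big_split /a mulr_sumr; apply: eq_bigr => j _ /=.
    by rewrite -sgE; ring.
  have := le_trans (ler_wpM2l (ltW d0) low) (le_trans hx up).
  rewrite -subr_ge0 mulr_sumr -sumrB.
  under eq_bigr do rewrite mulr_sumr -sumrB.
  rewrite pair_big /= => /le_trans; apply.
  rewrite le_eqVlt; apply/orP; left; apply/eqP.
  by apply: eq_bigr => -[i j] _ /=; rewrite c'E /F /=; ring.
have d20 : 0 < d / 2 by rewrite divr_gt0.
have [s [s0 hs]] := greedy_minimax d20 FD hF.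
exists s; split => // k l kn ln kl; have := hs (Ordinal kn, Ordinal ln).
rewrite /F /= kl; under eq_bigr do rewrite mul1r.
rewrite sumrB big_const_seq count_predT iter_addr_0 -[d *+ _]mulr_natr.
by rewrite mulNr; lra.
Qed.

Lemma average_mean (s : seq P) : (0 < size s)%N ->
  is_mean (fun f : P -> R => (\sum_(x <- s) f x) / (size s)%:R).
Proof.
move=> s0; have s0' : 0 < (size s)%:R :> R by rewrite ltr0n.
split=> [f g|c f|f g fg|].
- by rewrite big_split /= mulrDl.
- by rewrite -mulr_sumr mulrA.
- by rewrite ler_pM2r ?invr_gt0//; apply: ler_sum.
- by rewrite big_const_seq count_predT iter_addr_0 divff ?gt_eqF.
Qed.

Definition universally_tb (W : set (P -> R)) : Prop :=
  forall (U : set_system nat) (mu : nat -> (P -> R) -> R),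
    UltraFilter U -> (forall n, is_mean (mu n)) -> mean_tb U mu W.

(** Otherwise the averages over the lists of [l1_seq_separated] keep all terms at mutual distance
    [d / 2] in the limit, while a finite [d / 4]-net must put two terms around one centre. *)
Lemma universally_tb_l1_free (W : set (P -> R)) (w : nat -> P -> R) (B d : R) :
  universally_tb W -> 0 < d -> (forall k x, `|w k x| <= B) ->
  (forall k, W (w k)) ->
  exists (n : nat) (a : nat -> R), forall x,
    `|\sum_(k < n) a k * w k x| < d * \sum_(k < n) `|a k|.
Proof.
move=> Wtb d0 wB Ww; apply: contrapT => hN.
have hw (m : nat) (a : nat -> R) : exists x,
    d * \sum_(k < m) `|a k| <= `|\sum_(k < m) a k * w k x|.
  apply: contrapT => h; apply: hN; exists m, a => x; rewrite ltNge.
  by apply/negP => ?; apply: h; exists x.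
have /choice[s hs] := fun n => l1_seq_separated n d0 wB hw.
(* The [n]-th mean separates the first [n] terms only; a free ultrafilter eventually sees every
   pair. *)
have [U [UU Uoo]] := @ultraFilterLemma nat \oo _.
pose mu n (f : P -> R) := (\sum_(x <- s n) f x) / (size (s n))%:R.
have mu_mean n : is_mean (mu n) by apply: average_mean; case: (hs n).
have [|N [l [_ hl]]] := Wtb U mu UU mu_mean (d / 4); first by rewrite divr_gt0.
have /choice[pos hpos] k : exists i : 'I_N, limit_close U mu (d / 4) (w k) (l i).
  by have [i iN ?] := hl _ (Ww k); exists (Ordinal iN).
have /injectivePn[k [j kj pkj]] :
    ~~ injectiveb (fun k : 'I_N.+1 => pos k).
  apply/negP => /injectiveP /leq_card.
  by rewrite !card_ord ltnn.
have Un : U [set n | (maxn k j < n)%N] by apply: Uoo; exists (maxn k j).+1.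
have [n [n1 [n2 n3]]] :=
  filter_ex (filterI (hpos k) (filterI (hpos j) Un)).
have [hD hZ hle _] := mu_mean n.
have {}n3 : (maxn k j < n)%N by [].
have sn0 : 0 < (size (s n))%:R :> R by rewrite ltr0n; case: (hs n).
have : d / 2 <= mu n (fun x => `|w k x - w j x|).
  rewrite /mu ler_pdivlMr //; apply: (hs n).2 => //.
  - exact: leq_ltn_trans (leq_maxl _ _) n3.
  - exact: leq_ltn_trans (leq_maxr _ _) n3.
have : mu n (fun x => `|w k x - w j x|) <=
    mu n (fun x => `|w k x - l (pos k) x|) +
    mu n (fun x => `|w j x - l (pos k) x|).
  rewrite -hD; apply: hle => x.
  by rewrite (distrC (w j x)); exact: ler_distD.
by move: n1 n2; rewrite /= -pkj; lra.
Qed.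

End EllOneFree.

(** * Absolutely convex hulls and gauges *)

Section TbCalculus.
Context {R : realType} {P : Type}.

(** The real index is the sum of the absolute values of the coefficients: the function lies in that
    multiple of the absolutely convex hull of [G]. *)
Inductive combination (G : set (P -> R)) : R -> (P -> R) -> Prop :=
| combination_nil : combination G 0 (fun=> 0)
| combination_cons c g s w : G g -> combination G s w ->
    combination G (`|c| + s) (fun x => c * g x + w x).

Variables (U : set_system nat) (mu : nat -> (P -> R) -> R).
Hypotheses (UU : UltraFilter U) (mu_mean : forall n, is_mean (mu n)).

Lemma limit_close_unif (e e' : R) (g h : P -> R) : e' < e ->
  (forall x, `|g x - h x| <= e') -> limit_close U mu e g h.
Proof.
move=> ee' gh; rewrite /limit_close (_ : [set n | _] = setT); first exact: filterT.
apply/seteqP; split => // n _ /=; apply: le_lt_trans ee'.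
have [_ _ hle _] := mu_mean n.
by rewrite -(mean_cst (mu_mean n) e'); exact: hle.
Qed.

Lemma limit_close_trans (e1 e2 : R) (f g h : P -> R) :
  limit_close U mu e1 f g -> limit_close U mu e2 g h ->
  limit_close U mu (e1 + e2) f h.
Proof.
apply: filterS2 => n /= h1 h2; apply: le_lt_trans (ltrD h1 h2).
have [hD _ hle _] := mu_mean n; rewrite -hD; apply: hle => x.
exact: ler_distD.
Qed.

Lemma limit_closeD (e1 e2 : R) (f g h k : P -> R) :
  limit_close U mu e1 f g -> limit_close U mu e2 h k ->
  limit_close U mu (e1 + e2) (fun x => f x + h x) (fun x => g x + k x).
Proof.
apply: filterS2 => n /= h1 h2; apply: le_lt_trans (ltrD h1 h2).
have [hD _ hle _] := mu_mean n; rewrite -hD; apply: hle => x.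
by rewrite opprD addrACA; exact: ler_normD.
Qed.

Lemma mean_tbD (A B : set (P -> R)) : mean_tb U mu A -> mean_tb U mu B ->
  mean_tb U mu [set f | exists a b, [/\ A a, B b & f = fun x => a x + b x]].
Proof.
move=> hA hB e e0; have e20 : 0 < e / 2 by rewrite divr_gt0.
have [N [l [lb hl]]] := hA _ e20; have [M [m [mb hm]]] := hB _ e20.
exists (N * M)%N, (fun i x => l (i %/ M)%N x + m (i %% M)%N x); split.
  move=> i; have [b1 h1] := lb (i %/ M)%N; have [b2 h2] := mb (i %% M)%N.
  by exists (b1 + b2) => x; apply: le_trans (ler_normD _ _) _; apply: lerD.
move=> _ [a [b [Aa Bb ->]]].
have [i iN hi] := hl _ Aa; have [j jM hj] := hm _ Bb.
have M0 : (0 < M)%N by apply: leq_trans jM.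
exists (i * M + j)%N.
  rewrite (@leq_trans (i.+1 * M)%N) ?leq_mul2r ?iN ?orbT// mulSn addnC.
  by rewrite ltn_add2r.
rewrite divnMDl// divn_small// addn0 modnMDl modn_small// (splitr e).
exact: limit_closeD.
Qed.

Lemma mean_tb_line (g : P -> R) (B S : R) : (forall x, `|g x| <= B) ->
  mean_tb U mu [set f | exists b, `|b| <= S /\ f = fun x => b * g x].
Proof.
(* A mesh [d] for the coefficient costs at most [d * (|B| + 1) = e / 2] uniformly. *)
move=> gB e e0; pose d := e / (2 * (`|B| + 1)).
have d0 : 0 < d by rewrite divr_gt0// mulr_gt0// ltr_wpDl.
exists (Num.truncn (2 * S / d)).+1, (fun k x => (k%:R * d - S) * g x); split.
  move=> k; exists (`|k%:R * d - S| * B) => x.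
  by rewrite normrM ler_wpM2l.
move=> _ [b [bS ->]]; move: (bS); rewrite ler_norml => /andP[Sb bS'].
have t0 : 0 <= (b + S) / d by rewrite divr_ge0 ?(ltW d0)//; lra.
exists (Num.truncn ((b + S) / d)).
  by rewrite ltnS; apply: le_truncn; rewrite ler_pM2r ?invr_gt0//; lra.
have /andP[h1 h2] := truncn_itv t0.
apply: (@limit_close_unif _ (e / 2)); first by lra.
move=> x; rewrite -mulrBl normrM.
have h3 : `|b - ((Num.truncn ((b + S) / d))%:R * d - S)| <= d.
  move: h1 h2; rewrite ler_pdivlMr// ltr_pdivrMr// -natr1.
  rewrite [(_ + 1) * d]mulrDl mul1r.
  by rewrite ler_norml => ? ?; apply/andP; split; lra.
apply: (@le_trans _ _ (d * (`|B| + 1))).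
  apply: ler_pM => //; apply: le_trans (gB x) _; have := ler_norm B; lra.
rewrite /d le_eqVlt; apply/orP; left; apply/eqP; field.
by rewrite gt_eqF// ltr_wpDl.
Qed.

Lemma mean_tb_sub (A B : set (P -> R)) :
  A `<=` B -> mean_tb U mu B -> mean_tb U mu A.
Proof.
move=> AB hB e /hB[N [l [lb hl]]]; exists N, l; split => // g /AB; exact: hl.
Qed.

Lemma mean_tb_approx (A : set (P -> R)) :
  (forall e : R, 0 < e -> exists2 B, mean_tb U mu B &
    forall f, A f -> exists2 g, B g & limit_close U mu e f g) ->
  mean_tb U mu A.
Proof.
move=> hA e e0; have e20 : 0 < e / 2 by rewrite divr_gt0.
have [B Btb AB] := hA _ e20; have [N [l [lb hl]]] := Btb _ e20.
exists N, l; split => // f /AB[g /hl[i iN hi] fg]; exists i => //.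
by rewrite (splitr e); exact: limit_close_trans fg hi.
Qed.

Lemma mean_tb_span (l : nat -> P -> R) (S : R) (N : nat) :
  (forall i, exists B, forall x, `|l i x| <= B) ->
  mean_tb U mu [set f | exists b : nat -> R, (forall i, `|b i| <= S) /\
    f = fun x => \sum_(i < N) b i * l i x].
Proof.
move=> lb; elim: N => [|N IHN].
  move=> e e0; exists 1%N, (fun _ _ => 0); split.
    by exists 0 => x; rewrite normr0.
  move=> _ [b [_ ->]]; exists 0%N => //; apply: limit_close_unif e0 _ => x.
  by rewrite big_ord0 subrr normr0.
have [B lB] := lb N; apply: mean_tb_sub (mean_tbD IHN (mean_tb_line S lB)).
move=> _ [b [bS ->]]; exists (fun x => \sum_(i < N) b i * l i x), (fun x => b N * l N x).
split; [by exists b|by exists (b N)|].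
by apply/funext => x; rewrite big_ord_recr.
Qed.

(** Combinations have unbounded length. Replacing each generator by a centre of a finite net gathers
    the coefficients on [N] functions, with an error proportional to their absolute sum and not to
    the length. *)
Lemma mean_tb_combination (G : set (P -> R)) (S : R) : mean_tb U mu G ->
  mean_tb U mu [set w | exists2 s, s <= S & combination G s w].
Proof.
move=> Gtb; apply: mean_tb_approx => e e0.
have e'0 : 0 < e / (`|S| + 1) by rewrite divr_gt0// ltr_wpDl.
have [N [l [lb hl]]] := Gtb _ e'0.
exists [set f | exists b : nat -> R, (forall i, `|b i| <= S) /\
    f = fun x => \sum_(i < N) b i * l i x]; first exact: mean_tb_span.
move=> w [s sS ws].
have [b [bs hb]] : exists b : nat -> R, (forall i, `|b i| <= s) /\
    U [set n | mu n (fun x => `|w x - \sum_(i < N) b i * l i x|) <=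
      s * (e / (`|S| + 1))].
  elim: {s sS} ws => [|c g s {}w Gg _ [b [bs hb]]].
    exists (fun=> 0); split; first by move=> i; rewrite normr0.
    rewrite (_ : [set n | _] = setT); first exact: filterT.
    apply/seteqP; split => // n _ /=; rewrite mul0r.
    rewrite -[leRHS](mean_cst (mu_mean n) 0); have [_ _ hle _] := mu_mean n.
    by apply: hle => x; rewrite big1 ?subr0 ?normr0// => i _; rewrite mul0r.
  have [k kN hk] := hl _ Gg.
  exists (fun i => c * (i == k)%:R + b i); split.
    move=> i; apply: le_trans (ler_normD _ _) _; apply: lerD => //.
    by rewrite normrM; case: (i == k); rewrite ?normr1 ?normr0 ?mulr1 ?mulr0.
  apply: filterS2 hb hk => n /= h1 /ltW h2.
  have [hD hZ hle _] := mu_mean n.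
  rewrite mulrDl; apply: le_trans _ (lerD (ler_wpM2l (normr_ge0 c) h2) h1).
  rewrite -hZ -hD; apply: hle => x.
  have -> : \sum_(i < N) (c * (i == k :> nat)%:R + b i) * l i x =
      c * l k x + \sum_(i < N) b i * l i x.
    under eq_bigr do rewrite mulrDl.
    rewrite big_split/=; congr (_ + _).
    rewrite (bigD1 (Ordinal kN))//= eqxx mulr1 big1 ?addr0// => i ik.
    by rewrite (_ : (i == k :> nat) = false) ?mulr0 ?mul0r//; apply/negbTE.
  by rewrite opprD addrACA -mulrBr -normrM; exact: ler_normD.
exists (fun x => \sum_(i < N) b i * l i x).
  by exists b; split => // i; exact: le_trans (bs i) sS.
apply: filterS hb => n /= /le_lt_trans; apply.
rewrite mulrA ltr_pdivrMr; last by rewrite ltr_wpDl.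
rewrite mulrC ltr_pM2l//; have := ler_norm S; lra.
Qed.

End TbCalculus.

Section Combinations.
Context {R : realType} {P : Type}.
Variable G : set (P -> R).
Hypothesis G1 : bounded_by1 G.

Lemma combination_ge0 s w : combination G s w -> 0 <= s.
Proof. by elim=> // c g {}s {}w _ _ s0; rewrite addr_ge0. Qed.

Lemma combination_le s w : combination G s w -> forall x, `|w x| <= s.
Proof.
elim=> [x|c g {}s {}w Gg _ IH x]; first by rewrite normr0.
apply: le_trans (ler_normD _ _) _; apply: lerD => //.
by rewrite normrM -[leRHS]mulr1 ler_wpM2l// G1.
Qed.

Lemma combinationD s t v w : combination G s v -> combination G t w ->
  combination G (s + t) (fun x => v x + w x).
Proof.
move=> hv hw; elim: hv => [|c g {}s {}v Gg _ IH].
  by rewrite add0r; under eq_fun do rewrite add0r.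
by rewrite -addrA; under eq_fun do rewrite -addrA; constructor.
Qed.

Lemma combinationZ a s w : combination G s w ->
  combination G (`|a| * s) (fun x => a * w x).
Proof.
elim=> [|c g {}s {}w Gg _ IH].
  by rewrite mulr0; under eq_fun do rewrite mulr0; constructor.
rewrite mulrDr -normrM; under eq_fun do rewrite mulrDr mulrA.
by constructor.
Qed.

Lemma combination1 g : G g -> combination G 1 g.
Proof.
move=> Gg; have := combination_cons 1 Gg (combination_nil G).
by rewrite normr1 addr0; under eq_fun do rewrite addr0 mul1r.
Qed.

(* The gauges of the Davis-Figiel-Johnson-Pelczynski construction: up to a
   factor 2, [gauge_ball n s] is the [s]-ball of the gauge of
   [2^n W + 2^-n B], with [W] the absolutely convex hull of [G] and [B] the
   unit ball for the supremum norm. *)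
Definition gauge_ball (n : nat) (s : R) (y : P -> R) : Prop :=
  exists t w, [/\ combination G t w, t <= 2 ^+ n * s &
    forall x, `|y x - w x| <= s / 2 ^+ n].

Lemma gauge_ball_ge0 n s y : gauge_ball n s y -> 0 <= s.
Proof.
move=> [t [w [/combination_ge0 t0 ts _]]].
by have := le_trans t0 ts; rewrite pmulr_rge0// exprn_gt0.
Qed.

Lemma gauge_ball_le n s s' y : s <= s' -> gauge_ball n s y -> gauge_ball n s' y.
Proof.
move=> ss' [t [w [tw ts yw]]]; exists t, w; split=> //.
  by apply: le_trans ts _; rewrite ler_pM2l// exprn_gt0.
move=> x; apply: le_trans (yw x) _.
by rewrite ler_pM2r// invr_gt0 exprn_gt0.
Qed.

Lemma gauge_ballD n s s' y y' : gauge_ball n s y -> gauge_ball n s' y' ->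
  gauge_ball n (s + s') (fun x => y x + y' x).
Proof.
move=> [t [w [tw ts yw]]] [t' [w' [tw' ts' yw']]].
exists (t + t'), (fun x => w x + w' x); split.
- exact: combinationD.
- by rewrite mulrDr lerD.
- move=> x; rewrite mulrDl opprD addrACA.
  by apply: le_trans (ler_normD _ _) _; apply: lerD.
Qed.

Lemma gauge_ballZ n a s y : gauge_ball n s y ->
  gauge_ball n (`|a| * s) (fun x => a * y x).
Proof.
move=> [t [w [tw ts yw]]]; exists (`|a| * t), (fun x => a * w x); split.
- exact: combinationZ.
- by rewrite mulrCA ler_wpM2l.
- by move=> x; rewrite -mulrBr normrM -mulrA ler_wpM2l.
Qed.

Lemma gauge_ball0 n s : 0 <= s -> gauge_ball n s (fun=> 0).
Proof.
move=> s0; exists 0, (fun=> 0); split; first by constructor.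
  by rewrite mulr_ge0// exprn_ge0.
by move=> x; rewrite subrr normr0 divr_ge0// exprn_ge0.
Qed.

Lemma gauge_ball_unif n s y : (forall x, `|y x| <= s / 2 ^+ n) -> 0 <= s ->
  gauge_ball n s y.
Proof.
move=> ys s0; exists 0, (fun=> 0); split; first by constructor.
  by rewrite mulr_ge0// exprn_ge0.
by move=> x; rewrite subr0.
Qed.

Lemma gauge_ball_perturb n s y z d : gauge_ball n s y ->
  (forall x, `|z x - y x| <= d / 2 ^+ n) -> 0 <= d -> gauge_ball n (s + d) z.
Proof.
move=> ys zy d0; have := gauge_ballD ys (gauge_ball_unif zy d0).
by under eq_fun do rewrite addrC subrK.
Qed.

(** The gauges are pairwise equivalent, so finitely many of them are controlled by any single
    one. *)
Lemma gauge_ball_shift n m s y : gauge_ball n s y ->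
  gauge_ball m (2 ^+ (n + m) * s) y.
Proof.
move=> ys; have s0 := gauge_ball_ge0 ys; case: ys => t [w [tw ts yw]].
have e1 k : 1 <= 2 ^+ k :> R by rewrite exprn_ege1// ler1n.
have e0 k : 0 < 2 ^+ k :> R by rewrite exprn_gt0.
exists t, w; split=> //.
  apply: le_trans ts _; rewrite exprD !mulrA ler_wpM2r//.
  by rewrite mulrAC ler_peMl ?(ltW (e0 n))// mulr_ege1.
move=> x; apply: le_trans (yw x) _.
rewrite exprD mulrAC mulfK ?gt_eqF// mulrC ler_wpM2r//.
by apply: le_trans (_ : 1 <= _) => //; rewrite invf_le1.
Qed.

Lemma gauge_ball_sup s y : gauge_ball 0 s y -> forall x, `|y x| <= 2 * s.
Proof.
move=> [t [w [tw ts yw]]] x; rewrite -(subrK (w x) (y x)).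
apply: le_trans (ler_normD _ _) _; rewrite mulr_natl mulr2n; apply: lerD.
  by have := yw x; rewrite expr0 divr1.
by apply: le_trans (combination_le tw x) _; rewrite expr0 mul1r in ts.
Qed.

(** The [n]-th gauge places these functions within [s / 2 ^+ n] of a fixed multiple of the hull. *)
Lemma universally_tb_gauge (s : R) : universally_tb G ->
  universally_tb [set y | forall n, gauge_ball n s y].
Proof.
move=> Gtb U mu UU mu_mean; apply: mean_tb_approx => // e e0.
have [n ne] : exists n : nat, s / 2 ^+ n < e.
  exists (Num.truncn (`|s| / e)).+1; rewrite ltr_pdivrMr ?exprn_gt0//.
  rewrite mulrC -ltr_pdivrMr//; apply: le_lt_trans (_ : `|s| / e < _).
    by rewrite ler_pM2r ?invr_gt0// ler_norm.
  apply: lt_le_trans (truncnS_gt _) _; rewrite -natrX ler_nat.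
  by rewrite ltnW// ltn_expl.
exists [set w | exists2 t, t <= 2 ^+ n * s & combination G t w].
  exact/mean_tb_combination/Gtb.
move=> y /(_ n)[t [w [tw ts yw]]]; exists w; first by exists t.
exact: limit_close_unif ne yw.
Qed.

End Combinations.

(** * The interpolation space *)

Section InterpolationSpace.
Context {R : realType} {P : Type}.

(* The gauges are glued along [c_0] rather than along [l_2]. *)
Definition interp_set (G : set (P -> R)) : set (P -> R) :=
  [set y | forall e : R, 0 < e ->
    exists n0, forall n, (n0 <= n)%N -> gauge_ball G n e y].

Definition interp_pred (G : set (P -> R)) : {pred P -> R} :=
  fun y => `[< interp_set G y >].

(** The bound [G1] is a parameter of the type because definiteness of the norm, which the normed
    structure on the type must provide, relies on it. *)
Record interp (G : set (P -> R)) (G1 : bounded_by1 G) := Interp {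
  interp_val : P -> R;
  _ : interp_pred G interp_val }.

Variables (G : set (P -> R)) (G1 : bounded_by1 G).

HB.instance Definition _ := [isSub for @interp_val G G1].
HB.instance Definition _ := [Choice of interp G1 by <:].

Fact interp_submod : submod_closed (interp_pred G).
Proof.
split.
  apply/asboolP => e e0; exists 0%N => n _; exact/gauge_ball0/ltW.
move=> a u v /asboolP hu /asboolP hv; apply/asboolP => e e0.
have d0 : 0 < e / 2 / (`|a| + 1) by rewrite !divr_gt0// ltr_wpDl.
have [n1 h1] := hu _ d0; have [n2 h2] := hv (e / 2) ltac:(by rewrite divr_gt0).
exists (maxn n1 n2) => n; rewrite geq_max => /andP[/h1{}h1 /h2{}h2].
rewrite (splitr e); apply: gauge_ballD h2.
apply: gauge_ball_le (gauge_ballZ a h1).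
rewrite mulrCA ger_pMr ?divr_gt0// ler_pdivrMr ?mul1r ?ltr_wpDl//.
by rewrite lerDl.
Qed.

HB.instance Definition _ := GRing.isSubmodClosed.Build R (P -> R)
  (interp_pred G) interp_submod.
HB.instance Definition _ := [SubChoice_isSubLmodule of interp G1 by <:].

Definition gauge_bounds (y : P -> R) : set R := [set s | forall n, gauge_ball G n s y].

Definition interp_norm (y : interp G1) : R := inf (gauge_bounds (val y)).

Lemma gauge_bounds_nonempty (y : interp G1) : gauge_bounds (val y) !=set0.
Proof.
have /asboolP/(_ 1 ltr01)[n0 hn0] := valP y.
have hn := hn0 n0 (leqnn _).
exists (1 + \sum_(m < n0) 2 ^+ (n0 + m)) => n.
have [/hn0|nn0] := leqP n0 n.
  by move=> h; apply: gauge_ball_le h; rewrite lerDl sumr_ge0.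
apply: gauge_ball_le (gauge_ball_shift n hn); rewrite mulr1.
by rewrite (bigD1 (Ordinal nn0))//= addrCA lerDl addr_ge0// sumr_ge0.
Qed.

Lemma gauge_bounds_lb (y : P -> R) : has_lbound (gauge_bounds y).
Proof. by exists 0 => s /(_ 0%N) /gauge_ball_ge0. Qed.

Lemma interp_norm_lt (y : interp G1) (s : R) :
  interp_norm y < s -> forall n, gauge_ball G n s (val y).
Proof.
move=> /(inf_lt (gauge_bounds_nonempty y))[t ht ts] n.
exact: gauge_ball_le (ltW ts) (ht n).
Qed.

Lemma interp_norm_le (y : interp G1) (s : R) :
  (forall n, gauge_ball G n s (val y)) -> interp_norm y <= s.
Proof. by move=> hs; apply: ge_inf => //; exact: gauge_bounds_lb. Qed.

Lemma interp_norm_sup (y : interp G1) (x : P) : `|val y x| <= 2 * interp_norm y.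
Proof.
rewrite mulrC -ler_pdivrMr//; apply/ler_addgt0Pr => e e0.
rewrite ler_pdivrMr// mulrC.
have := @interp_norm_lt y (interp_norm y + e); rewrite ltrDl => /(_ e0 0%N).
by move/(gauge_ball_sup G1).
Qed.

Lemma interp_normD (y z : interp G1) :
  interp_norm (y + z) <= interp_norm y + interp_norm z.
Proof.
apply/ler_addgt0Pr => e e0; rewrite (splitr e) addrACA.
apply: interp_norm_le => n.
by apply: gauge_ballD; apply: interp_norm_lt; rewrite ltrDl divr_gt0.
Qed.

Lemma interp_normZ_le (a : R) (y : interp G1) :
  interp_norm (a *: y) <= `|a| * interp_norm y.
Proof.
apply/ler_addgt0Pr => e e0; have d0 : 0 < e / (`|a| + 1).
  by rewrite divr_gt0// ltr_wpDl.
apply: (@le_trans _ _ (`|a| * (interp_norm y + e / (`|a| + 1)))).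
  apply: interp_norm_le => n; apply: gauge_ballZ; apply: interp_norm_lt.
  by rewrite ltrDl.
by rewrite mulrDr lerD2l mulrCA ger_pMr// ler_pdivrMr ?ltr_wpDl// mul1r lerDl.
Qed.

Lemma interp_norm_ge0 (y : interp G1) : 0 <= interp_norm y.
Proof.
apply: lb_le_inf; first exact: gauge_bounds_nonempty.
by move=> s /(_ 0%N)/gauge_ball_ge0.
Qed.

Lemma interp_normZ (a : R) (y : interp G1) :
  interp_norm (a *: y) = `|a| * interp_norm y.
Proof.
apply/eqP; rewrite eq_le interp_normZ_le/=.
have [->|a0] := eqVneq a 0; first by rewrite normr0 mul0r interp_norm_ge0.
rewrite -ler_pdivlMl ?normr_gt0// -normfV.
by apply: le_trans (interp_normZ_le _ _); rewrite scalerA mulVf// scale1r.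
Qed.

Lemma interp_norm0_eq0 (y : interp G1) : interp_norm y = 0 -> y = 0.
Proof.
move=> y0; apply: val_inj; apply/funext => x /=.
by apply/eqP; rewrite -normr_le0; have := interp_norm_sup y x; rewrite y0 mulr0.
Qed.

HB.instance Definition _ := Lmodule_isNormed.Build R (interp G1)
  interp_normD interp_normZ interp_norm0_eq0.

(** The limit is taken pointwise. The gauge balls are not assumed closed; a uniformly small error is
    absorbed by enlarging the radius. *)
Lemma interp_complete (F : set_system (interp G1)) :
  ProperFilter F -> cauchy F -> cvg F.
Proof.
move=> FF /cauchyP Fc.
have ball_unif (y u : interp G1) e x : ball y e u -> `|val u x - val y x| <= 2 * e.
  rewrite -ball_normE /= => /ltW yu; rewrite distrC.
  by apply: le_trans (interp_norm_sup (y - u) x) _; rewrite ler_pM2l.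
have ev_cvg x : cvg ((fun y : interp G1 => val y x) @ F).
  apply: cauchy_cvg; apply: cauchy_exP => e e0.
  have [|y Fy] := Fc (e / 4); first by rewrite divr_gt0.
  exists (val y x); suff : F [set u | ball (val y x) e (val u x)] by [].
  apply: filterS Fy => u /(ball_unif _ _ _ x) h.
  by rewrite -ball_normE /ball_ /= distrC; apply: le_lt_trans h _; lra.
pose z x := lim ((fun y : interp G1 => val y x) @ F).
have z_unif y e : F (ball y e) -> forall x, `|z x - val y x| <= 2 * e.
  move=> Fy x; rewrite distrC.
  rewrite -(cvg_lim (@Rhausdorff R)
    (cvg_norm (cvgB (cvg_cst (val y x)) (ev_cvg x)))).
  apply: limr_le; first exact: is_cvg_norm (is_cvgB (is_cvg_cst _) (ev_cvg x)).
  by apply: filterS Fy => u /(ball_unif _ _ _ x); rewrite distrC.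
have z_gauge y e n : 0 < e -> F (ball y e) ->
    gauge_ball G n (2 * e) (fun x => z x - val y x).
  (* Both [z] and [u] are uniformly within [e / 2 ^+ n / 2] of [v], hence within [e / 2 ^+ n] of
     each other, which costs a further [e] in the [n]-th gauge. *)
  move=> e0 Fy; have d0 : 0 < e / 2 ^+ n / 4 by rewrite !divr_gt0// exprn_gt0.
  have [v Fv] := Fc _ d0.
  have [u [yu vu]] := filter_ex (filterI Fy Fv).
  rewrite mulr_natl mulr2n.
  have uy : gauge_ball G n e (val (u - y)).
    apply: interp_norm_lt; suff : `|u - y| < e by [].
    by move: yu; rewrite -ball_normE /= distrC.
  apply: gauge_ball_perturb uy _ (ltW e0) => x /=.
  have := z_unif _ _ Fv x; have := ball_unif _ _ _ x vu.
  rewrite distrC => h1 h2.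
  have -> : z x - val y x - (val u x - val y x) =
      z x - val v x + (val v x - val u x) by ring.
  by apply: le_trans (ler_normD _ _) _; lra.
have z_in : interp_pred G z.
  apply/asboolP => e e0; have e40 : 0 < e / 4 by rewrite divr_gt0.
  have [y Fy] := Fc _ e40.
  have /asboolP/(_ (e / 2))[|n0 hn0] := valP y; first by rewrite divr_gt0.
  exists n0 => n /hn0 hy; rewrite (_ : e = e / 2 + 2 * (e / 4)); last by lra.
  rewrite (_ : z = fun x => val y x + (z x - val y x)); last first.
    by apply/funext => x; rewrite addrC subrK.
  exact: gauge_ballD hy (z_gauge _ _ _ e40 Fy).
apply/cvg_ex; exists (Interp G1 z_in); apply/cvg_ballP => e e0.
have e40 : 0 < e / 4 by rewrite divr_gt0.
have [y Fy] := Fc _ e40; apply: filterS (Fy) => u yu.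
have : `|Interp G1 z_in - y| <= 2 * (e / 4).
  by apply: interp_norm_le => n; exact: z_gauge.
move: yu; rewrite -!ball_normE /ball_ /= => yu zy.
by apply: le_lt_trans (ler_distD y _ _) _; lra.
Qed.

HB.instance Definition _ := Uniform_isComplete.Build (interp G1) interp_complete.

End InterpolationSpace.

Lemma interpolation_space (R : realType) (P : Type) (G : set (P -> R)) :
  bounded_by1 G ->
  exists (Y : completeNormedModType R) (ev : {linear Y -> (P -> R)}),
    [/\ forall y, interp_set G (ev y),
        forall z, interp_set G z -> exists y, ev y = z &
        (forall (y : Y) s, `|y| < s -> forall n, gauge_ball G n s (ev y)) /\
        (forall (y : Y) s, (forall n, gauge_ball G n s (ev y)) -> `|y| <= s)].
Proof.
move=> G1; exists (interp G1 : completeNormedModType R),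
  (val : {linear interp G1 -> (P -> R)}).
split.
- by move=> y; have /asboolP := valP y.
- by move=> z /asboolP hz; exists (Interp G1 hz).
- by split=> y s; 
    [exact: (@interp_norm_lt _ _ _ _ y s)|exact: (@interp_norm_le _ _ _ _ y s)].
Qed.

(** * Finitely supported sequences in [l_1] *)

Section FiniteSupport.
Context {R : realType}.

Lemma finite_support_l1 (a : nat -> R) (n : nat) :
  (forall k, (n <= k)%N -> a k = 0) ->
  in_l1 a /\ l1norm a = \sum_(k < n) `|a k|.
Proof.
move=> an.
have h : series (fun k => `|a k|) @ \oo --> \sum_(k < n) `|a k|.
  apply: cvg_near_cst; near=> m.
  have nm : (n <= m)%N by near: m; exists n.
  rewrite /series/= (big_cat_nat (leq0n n) nm)/= big_mkord [X in _ + X]big_nat_cond.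
  rewrite [X in _ + X]big1 ?addr0// => k /andP[/andP[nk _] _].
  by rewrite an// normr0.
split; first by apply/cvg_ex; exists (\sum_(k < n) `|a k|).
exact: cvg_lim.
Unshelve. all: by end_near. Qed.

(** With [a] constant equal to 1 and [n = 1], this is the unit vector at [k0]. *)
Definition shifted_block (a : nat -> R) (k0 n : nat) : nat -> R :=
  fun k => if (k0 <= k < k0 + n)%N then a (k - k0)%N else 0.

Lemma shifted_block_l1 (a : nat -> R) (k0 n : nat) :
  in_l1 (shifted_block a k0 n) /\
  l1norm (shifted_block a k0 n) = \sum_(k < n) `|a k|.
Proof.
have hs k : (k0 + n <= k)%N -> shifted_block a k0 n k = 0.
  by move=> kn; rewrite /shifted_block ltnNge kn andbF.
have [h1 ->] := finite_support_l1 hs; split=> //.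
rewrite big_split_ord/= big1 ?add0r => [|i _].
  by apply: eq_bigr => i _; rewrite /shifted_block leq_addr ltn_add2l ltn_ord addKn.
by rewrite /shifted_block leqNgt ltn_ord normr0.
Qed.

Variables (V : lmodType R) (T : (nat -> R) -> V).
Hypothesis T_linear : forall (lam : R) (a b : nat -> R), in_l1 a -> in_l1 b ->
  T (fun k => lam * a k + b k) = lam *: T a + T b.

Lemma shifted_block_linear (a : nat -> R) (k0 n : nat) :
  T (shifted_block a k0 n) =
  \sum_(i < n) a i *: T (shifted_block (fun=> 1) (k0 + i) 1).
Proof.
elim: n => [|n IHn].
  rewrite big_ord0; have [h0 _] := shifted_block_l1 a k0 0.
  have := T_linear (-1) h0 h0; rewrite scaleN1r addNr => <-.
  congr T; apply/funext => k; rewrite /shifted_block addn0.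
  by rewrite ltnNge andbN mulr0 addr0.
rewrite big_ord_recr/= -IHn addrC -T_linear; last 2 first.
- by have [] := shifted_block_l1 (fun=> 1) (k0 + n) 1.
- by have [] := shifted_block_l1 a k0 n.
congr T; apply/funext => k; rewrite /shifted_block addn1 addnS ltnS.
have [kk|kk] := leqP k0 k; last first.
  by rewrite /= leqNgt ltn_addr//= mulr0 addr0.
rewrite /=; case: (ltngtP k (k0 + n)) => [kn|kn|->] /=;
by rewrite ?mulr0 ?add0r ?addKn ?mulr1 ?addr0.
Qed.

End FiniteSupport.

(** * Absence of [l_1] in the interpolation space *)

Section NoEllOne.
Context {R : realType} {P : Type}.
Variables (G : set (P -> R)) (Y : normedModType R) (ev : {linear Y -> (P -> R)}).
Hypotheses (p0 : P) (G1 : bounded_by1 G) (Gtb : universally_tb G).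
Hypothesis ev_interp : forall y, interp_set G (ev y).
Hypothesis norm_lt : forall (y : Y) s, `|y| < s -> forall n, gauge_ball G n s (ev y).
Hypothesis norm_le : forall (y : Y) s, (forall n, gauge_ball G n s (ev y)) -> `|y| <= s.

(* Against a copy of [l_1], blocks that are small in the supremum norm are
   summed greedily: a new block is negligible for the finitely many gauges
   that still see the previous sum, so norms grow by [c / 2] per block only. *)
Lemma interp_no_l1 : ~ contains_l1 Y.
Proof.
move=> [T [c [C [c0 [T_lin T_bd]]]]].
have blk1 k : in_l1 (shifted_block (fun=> 1 : R) k 1) /\
    l1norm (shifted_block (fun=> 1 : R) k 1) = 1.
  have [h1 ->] := shifted_block_l1 (fun=> 1 : R) k 1.
  by rewrite big_ord1 normr1.
have C0 : 0 < C.
  have [h1 h2] := blk1 0%N; have [h3 h4] := T_bd _ h1.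
  by apply: lt_le_trans c0 _; have := le_trans h3 h4; rewrite h2 !mulr1.
have small_block (k0 : nat) (e : R) : 0 < e -> exists (n : nat) (a : nat -> R),
    \sum_(k < n) `|a k| = 1 /\
    forall x, `|ev (T (shifted_block a k0 n)) x| <= e.
  move=> e0; pose w k := ev (T (shifted_block (fun=> 1) (k0 + k) 1)).
  have w_gauge k n : gauge_ball G n (C + 1) (w k).
    apply: norm_lt; have [h1 h2] := blk1 (k0 + k)%N.
    by have [_] := T_bd _ h1; rewrite h2 mulr1 => /le_lt_trans; apply; rewrite ltrDl.
  have w_bd k x : `|w k x| <= 2 * (C + 1).
    by apply: (gauge_ball_sup G1); exact: w_gauge.
  have [n [a ha]] := universally_tb_l1_free
    (universally_tb_gauge (C + 1) Gtb) e0 w_bd w_gauge.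
  set A := \sum_(k < n) `|a k| in ha.
  have A0 : 0 < A by have := le_lt_trans (normr_ge0 _) (ha p0); rewrite pmulr_rgt0.
  exists n, (fun k => A^-1 * a k); split.
    under eq_bigr do rewrite normrM.
    by rewrite -mulr_sumr gtr0_norm ?invr_gt0// mulVf// gt_eqF.
  move=> x; rewrite (shifted_block_linear T_lin) raddf_sum /=.
  have -> : (\sum_(i < n) ev ((A^-1 * a i) *:
      T (shifted_block (fun=> 1) (k0 + i) 1))) x =
      A^-1 * \sum_(i < n) a i * w i x.
    rewrite fct_sumE mulr_sumr; apply: eq_bigr => i _.
    by rewrite linearZ /= mulrA.
  rewrite normrM gtr0_norm ?invr_gt0// mulrC ler_pdivrMr//.
  exact/ltW/ha.
have sums (J : nat) : exists (b : nat -> R) (k1 : nat),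
    [/\ forall k, (k1 <= k)%N -> b k = 0, \sum_(k < k1) `|b k| = J%:R &
      forall n, gauge_ball G n (C + 1 + J%:R * (c / 2)) (ev (T b))].
  elim: J => [|J [b [k1 [bk bJ hb]]]].
    exists (shifted_block (fun=> 0) 0 0), 0%N; split=> [k _||n].
    - by rewrite /shifted_block; case: (_ && _).
    - by rewrite big_ord0.
    rewrite (shifted_block_linear T_lin) big_ord0 linear0 mul0r addr0.
    by apply: gauge_ball0; rewrite addr_ge0// ltW.
  have c20 : 0 < c / 2 by rewrite divr_gt0.
  have [n0 hn0] := ev_interp (T b) c20.
  (* From [n0] on, the gauges of the old sum are at most [c / 2] and the block adds at most [C + 1];
     before [n0], this uniform bound makes the block cost at most [c / 2]. *)
  have [|m [a [a1 ha]]] := small_block k1 (c / 2 / 2 ^+ n0).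
    by rewrite divr_gt0// exprn_gt0.
  pose b' := shifted_block a k1 m.
  have [b'l1 b'norm] := shifted_block_l1 a k1 m.
  have [bl1 bnorm] := finite_support_l1 bk.
  exists (fun k => 1 * b k + b' k), (k1 + m)%N; split.
  - move=> k km; rewrite bk ?(leq_trans (leq_addr _ _) km)// mulr0 add0r.
    by rewrite /b' /shifted_block ltnNge km andbF.
  - rewrite big_split_ord/= -natr1 -bJ -[X in _ = _ + X]a1; congr (_ + _);
      apply: eq_bigr => i _.
      by rewrite mul1r /b' /shifted_block leqNgt ltn_ord addr0.
    rewrite bk ?leq_addr// mulr0 add0r /b' /shifted_block leq_addr ltn_add2l.
    by rewrite ltn_ord addKn.
  move=> n; rewrite T_lin// scale1r linearD.
  have [nn0|n0n] := leqP n0 n.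
    have : gauge_ball G n (C + 1) (ev (T b')).
      apply: norm_lt; have [_] := T_bd _ b'l1; rewrite b'norm a1 mulr1.
      by move=> /le_lt_trans; apply; rewrite ltrDl.
    move=> /(gauge_ballD (hn0 n nn0)); apply: gauge_ball_le.
    have : 0 <= J%:R * (c / 2) by rewrite mulr_ge0// ltW.
    by rewrite -[J.+1%:R]natr1 mulrDl; lra.
  have : gauge_ball G n (c / 2) (ev (T b')).
    apply: gauge_ball_unif (ltW c20) => x; apply: le_trans (ha x) _.
    by rewrite ler_pM2l// lef_pV2 ?posrE ?exprn_gt0// ler_weXn2l ?ler1n// ltnW.
  move=> /(gauge_ballD (hb n)); apply: gauge_ball_le.
  by rewrite -[J.+1%:R]natr1 mulrDl mul1r addrA.
(* The sum of [J] blocks has norm at least [c * J] and at most [C + 1 + J * (c / 2)]. *)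
have [J hJ] : exists J : nat, 2 * (C + 1) < J%:R * c.
  exists (Num.truncn (2 * (C + 1) / c)).+1; rewrite -ltr_pdivrMr//.
  exact: truncnS_gt.
have [b [k1 [bk bJ /norm_le hb]]] := sums J.
have [bl1 bnorm] := finite_support_l1 bk.
have [h1 _] := T_bd _ bl1; have := le_trans h1 hb.
by rewrite bnorm bJ; lra.
Qed.

End NoEllOne.

(** * The two separating families *)

Section CappedDistance.
Context {R : realType} {M : pseudoMetricType R}.

(* A pseudometric space only comes with its balls; this is the induced
   distance, capped at 1. *)
Definition cdist (x y : M) : R :=
  inf ([set e | 0 < e /\ ball x e y] `|` [set 1]).

Let cdist_lb (x y : M) : lbound ([set e : R | 0 < e /\ ball x e y] `|` [set 1]) 0.
Proof. by move=> e [[/ltW]|->]. Qed.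

Lemma cdist_ge0 x y : 0 <= cdist x y.
Proof. by apply: lb_le_inf; [exists 1; right|exact: cdist_lb]. Qed.

Lemma cdist_le1 x y : cdist x y <= 1.
Proof. by apply: ge_inf; [exists 0; exact: cdist_lb|right]. Qed.

Lemma ball_cdist x y e : 0 < e -> ball x e y -> cdist x y <= e.
Proof.
by move=> e0 xy; apply: ge_inf; [exists 0; exact: cdist_lb|left].
Qed.

Lemma cdist_ball x y e : cdist x y < e -> e <= 1 -> ball x e y.
Proof.
move=> xy e1; have [|e' h e'e] := inf_lt _ xy; first by exists 1; right.
case: h e'e => [[_ xe'] /ltW e'e|-> /lt_le_trans/(_ e1)]; last by rewrite ltxx.
exact: le_ball xe'.
Qed.

Lemma cdistxx x : cdist x x = 0.
Proof.
apply/eqP; rewrite eq_le cdist_ge0 andbT; apply/ler_addgt0Pr => e e0; rewrite add0r.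
by apply: ball_cdist => //; exact: ballxx.
Qed.

Lemma cdistC x y : cdist x y = cdist y x.
Proof.
by rewrite /cdist; congr (inf (_ `|` _)); apply/seteqP; split => e [e0 /ball_sym].
Qed.

Lemma cdist_triangle y x z : cdist x z <= cdist x y + cdist y z.
Proof.
apply/ler_addgt0Pr => e e0; rewrite (splitr e) addrACA.
have e20 : 0 < e / 2 by rewrite divr_gt0.
have adh u v : exists2 a, ([set e : R | 0 < e /\ ball u e v] `|` [set 1]) a &
    a < cdist u v + e / 2.
  apply: inf_adherent => //; split; first by exists 1; right.
  by exists 0; exact: cdist_lb.
have [a ha /ltW al] := adh x y; have [b hb /ltW bl] := adh y z.
apply: le_trans (lerD al bl); have a0 := cdist_lb ha; have b0 := cdist_lb hb.
case: ha => [[a0' xa]|->]; last by apply: le_trans (cdist_le1 _ _) _; rewrite lerDl.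
case: hb => [[b0' yb]|->]; last by apply: le_trans (cdist_le1 _ _) _; rewrite lerDr.
by apply: ball_cdist; [exact: addr_gt0|exact: ball_triangle xa yb].
Qed.

Lemma cdist_lip z x y : `|cdist z x - cdist z y| <= cdist x y.
Proof.
have h1 := cdist_triangle x z y; have h2 := cdist_triangle y z x.
by rewrite ler_norml; rewrite (cdistC y x) in h2; apply/andP; split; lra.
Qed.

Lemma cdist_continuous z : continuous (cdist z).
Proof.
move=> x; apply/cvg_ballP => e e0.
have e20 : 0 < e / 2 by rewrite divr_gt0.
apply: filterS (nbhsx_ballx x _ e20) => y /(ball_cdist e20) xy.
rewrite -ball_normE /ball_ /=; apply: le_lt_trans (cdist_lip _ _ _) _.
by apply: le_lt_trans xy _; lra.
Qed.

Lemma cdist_eq0 x y : hausdorff_space M -> cdist x y = 0 -> x = y.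
Proof.
move=> hM xy0; apply: contrapT => /eqP xy.
move: hM; rewrite ball_hausdorff => /(_ x y xy)[[e1 e2] /= ee].
pose e := Num.min 1 (Num.min e1%:num e2%:num).
have e0 : 0 < e by rewrite !lt_min ltr01 !gt0.
have : (ball x e1%:num `&` ball y e2%:num) y.
  split; last exact: ballxx.
  apply: (@le_ball _ _ _ e); first by rewrite !ge_min lexx orbT.
  by apply: cdist_ball; rewrite ?xy0// ge_min lexx.
by move/eqP: ee => ->.
Qed.

End CappedDistance.

Section TbUnions.
Context {R : realType} {P : Type}.
Variables (U : set_system nat) (mu : nat -> (P -> R) -> R).
Hypotheses (UU : UltraFilter U) (mu_mean : forall n, is_mean (mu n)).

Lemma mean_tbU (A B : set (P -> R)) : mean_tb U mu A -> mean_tb U mu B ->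
  mean_tb U mu (A `|` B).
Proof.
move=> hA hB e e0; have [N [l [lb hl]]] := hA e e0; have [N' [m [mb hm]]] := hB e e0.
exists (N + N')%N, (fun i => if (i < N)%N then l i else m (i - N)%N); split.
  by move=> i; case: ifP.
move=> g [/hl[i iN hi]|/hm[i iN hi]].
  by exists i; rewrite ?iN ?ltn_addr.
exists (N + i)%N; first by rewrite ltn_add2l.
by rewrite ltnNge leq_addr addKn.
Qed.

Lemma mean_tb_bigU (J : eqType) (s : seq J) (A : J -> set (P -> R)) :
  (forall j, mean_tb U mu (A j)) ->
  mean_tb U mu [set g | exists2 j, j \in s & A j g].
Proof.
move=> hA; elim: s => [e e0|j s IHs].
  exists 0%N, (fun _ _ => 0); split; first by exists 0 => x; rewrite normr0.
  by move=> g [j]; rewrite in_nil.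
apply: mean_tb_sub (mean_tbU (hA j) IHs) => g [k].
by rewrite inE => /orP[/eqP->|ks Ag]; [left|right; exists k].
Qed.

End TbUnions.

Lemma compact_finite_net (R : realType) (M : pseudoMetricType R) (e : R) :
  compact [set: M] -> 0 < e ->
  exists s : seq M, forall m, exists2 z, z \in s & ball z e m.
Proof.
move=> Mc e0; apply: contrapT => hN.
pose far (s : seq M) := [set m | forall z, z \in s -> ~ ball z e m].
have FF : ProperFilter (filter_from setT far).
  apply: filter_from_proper.
    apply: filter_from_filter; first by exists [::].
    move=> s t _ _; exists (s ++ t) => // m hm.
    by split=> z zs; apply: hm; rewrite mem_cat zs ?orbT.
  move=> s _; apply: contrapT => hs; apply: hN; exists s => m.
  apply: contrapT => hm; apply: hs; exists m => z zs zm; apply: hm.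
  by exists z.
have [c [_ hc]] := Mc _ FF filterT.
have [m [hm cm]] := hc _ _ (@in_filter_from _ _ setT far [:: c] I) (nbhsx_ballx c _ e0).
by apply: (hm c); rewrite ?mem_head.
Qed.

Section SplitCoordinates.
Context {R : realType} {M : pseudoMetricType R} {L : topologicalType} {I P : Type}.
Variables (r : I -> L) (f : I -> L -> M) (proj : P -> L) (coord : I -> P -> M).
Hypotheses (r_inj : injective r) (f_free : ~ has_M_independent_seq r f).
Hypothesis coordE : forall p i, proj p = r i \/ coord i p = f i (proj p).

(* A pattern of length [m] is prolonged by [m] further constraints, the [j]-th
   of which is violated on the whole fibre of [r (xi j)]; a point realizing the
   longer pattern thus projects outside these [m] points, where the values of
   the coordinates are those of the functions [f]. *)
Lemma coordinate_no_independent (z : M) (p q : R) : p < q ->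
  ~ independent_in [set g | exists i, g = fun x : P => cdist z (coord i x)] p q.
Proof.
move=> pq [g [gG g_ind]]; apply: f_free.
have /choice[xi gE] := gG.
have xi_inj : injective xi.
  (* A pattern that is high at [a] and low at [b] cannot be realized by one and the same
     function. *)
  move=> a b ab; apply: contrapT => /eqP neq_ab.
  have [x hx] := g_ind (maxn a b).+1 (fun i => i == a).
  have := hx a; have := hx b; rewrite !ltnS leq_maxl leq_maxr !gE ab eqxx.
  rewrite eq_sym (negbTE neq_ab) => /(_ isT) h1 /(_ isT) h2.
  by have := lt_le_trans pq (le_trans h2 h1); rewrite ltxx.
(* Each [f i] is a total function in the code and serves as its own extension. *)
exists xi, (fun n => f (xi n)); split => //; split => //.
exists [set m | cdist z m <= p], [set m | q <= cdist z m].
have cz : continuous (cdist z) by exact: cdist_continuous.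
split; first by apply: (closed_comp _ (@closed_le R p)) => x _; exact: cz.
split; first by apply: (closed_comp _ (@closed_ge R q)) => x _; exact: cz.
have disj : [set m | cdist z m <= p] `&` [set m | q <= cdist z m] = set0.
  apply/seteqP; split => // x [/= h1 h2].
  by have := lt_le_trans pq (le_trans h2 h1); rewrite ltxx.
split=> //; split=> [n|m eps].
  by rewrite -preimage_setI disj preimage_set0.
pose eps' i := if (i < m)%N then eps i
  else ~~ (q <= cdist z (f (xi i) (r (xi (i - m)%N)))).
have [x hx] := g_ind (m + m)%N eps'.
have proj_ne j : (j < m)%N -> proj x <> r (xi j).
  move=> jm pj; have := hx (m + j)%N.
  rewrite ltn_add2l jm gE /eps' ltnNge leq_addr addKn => /(_ isT).
  have [pr|->] := coordE x (xi (m + j)%N).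
    have /eqP : (m + j = j)%N by apply/xi_inj/r_inj; rewrite -pr -pj.
    by rewrite -[X in _ == X]add0n eqn_add2r => /eqP m0; rewrite m0 in jm.
  rewrite pj /=; case: leP => //= h1 h2.
  by have := lt_le_trans pq (le_trans h1 h2); rewrite ltxx.
exists (proj x) => i im; have := hx i.
rewrite ltn_addr// gE /eps' im => /(_ isT).
have [pr|->] := coordE x (xi i); first by case: (proj_ne i im).
by case: (eps i).
Qed.

(** Independence is excluded for one [z] at a time; a finite net of [M] then suffices, since [cdist]
    is 1-Lipschitz in [z]. *)
Lemma coordinate_tb : compact [set: M] ->
  universally_tb [set g | exists z i, g = fun x : P => cdist z (coord i x)].
Proof.
move=> Mc U mu UU mu_mean.
have zone z : mean_tb U mu [set g | exists i, g = fun x : P => cdist z (coord i x)].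
  apply: contrapT => /(mean_tbN_independent UU mu_mean)[|p [q [pq]]].
    by move=> _ [i ->] x; rewrite ger0_norm ?cdist_ge0 ?cdist_le1.
  exact: coordinate_no_independent.
apply: mean_tb_approx => // e e0; have e20 : 0 < e / 2 by rewrite divr_gt0.
have [D DM] := compact_finite_net Mc e20.
exists [set g | exists2 z, z \in D &
    [set g | exists i, g = fun x : P => cdist z (coord i x)] g].
  exact: mean_tb_bigU.
move=> _ [z [i ->]]; have [z' z'D z'z] := DM z.
exists (fun x => cdist z' (coord i x)); first by exists z' => //; exists i.
have ee : e / 2 < e by lra.
refine (limit_close_unif UU mu_mean ee _) => x.
rewrite !(cdistC _ (coord i x)); apply: le_trans (cdist_lip _ _ _) _.
by rewrite cdistC; exact: ball_cdist.
Qed.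

End SplitCoordinates.

(** * Functionals on a space without [l_1] *)

Section DualFunctionals.
Context {R : realType} {X : completeNormedModType R} {P : Type}.
Variables (phi : P -> X -> R) (C : R).
Hypotheses (C0 : 0 < C) (phiC : forall p x, `|phi p x| <= C * `|x|).
Hypothesis phi_linear :
  forall p (lam : R) (u v : X), phi p (lam *: u + v) = lam * phi p u + phi p v.

Lemma phi_sum p (n : nat) (a : nat -> R) (x : nat -> X) :
  phi p (\sum_(k < n) a k *: x k) = \sum_(k < n) a k * phi p (x k).
Proof.
elim: n => [|n IHn]; last by rewrite !big_ord_recr/= addrC phi_linear IHn addrC.
rewrite !big_ord0; have := phi_linear p (-1) 0 0.
by rewrite scaler0 addr0 mulN1r addNr.
Qed.

(** Rosenthal's argument: the points realizing the sign pattern of the coefficients and its opposite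
    give values differing by at least [q - p] times the [l_1] norm, and by at most [2 * C] times the
    norm in [X]. *)
Lemma independent_contains_l1 (x : nat -> X) (p q : R) : p < q ->
  (forall n, `|x n| <= 1) ->
  (forall (m : nat) (eps : nat -> bool), exists t, forall i, (i < m)%N ->
      if eps i then q <= phi t (x i) else phi t (x i) <= p) ->
  contains_l1 X.
Proof.
move=> pq x1 x_ind.
have lower n (a : nat -> R) :
    (q - p) / (2 * C) * \sum_(k < n) `|a k| <= `|\sum_(k < n) a k *: x k|.
  have [t ht] := x_ind n (fun k => 0 <= a k).
  have [u hu] := x_ind n (fun k => ~~ (0 <= a k)).
  have h : (q - p) * \sum_(k < n) `|a k| <=
      phi t (\sum_(k < n) a k *: x k) - phi u (\sum_(k < n) a k *: x k).
    rewrite !phi_sum mulr_sumr -sumrB; apply: ler_sum => k _; rewrite -mulrBr.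
    have := ht k (ltn_ord k); have := hu k (ltn_ord k).
    case: (leP 0 (a k)) => /= [ak|ak] h1 h2.
      by rewrite ger0_norm// mulrC ler_wpM2l// lerB.
    by rewrite ltr0_norm// mulrN -mulNr opprB mulrC ler_wnM2l ?(ltW ak)// lerB.
  rewrite mulrAC ler_pdivrMr ?mulr_gt0//; apply: le_trans h _.
  apply: le_trans (ler_norm _) _; apply: le_trans (ler_normB _ _) _.
  by apply: le_trans (lerD (phiC _ _) (phiC _ _)) _; lra.
have ncvg (a : nat -> R) : in_l1 a -> cvgn [normed series (fun k => a k *: x k)].
  apply: series_le_cvg => n; rewrite /= ?normr_ge0// normrZ -[leRHS]mulr1.
  by rewrite ler_wpM2l.
have scvg (a : nat -> R) : in_l1 a -> cvgn (series (fun k => a k *: x k)).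
  by move=> /ncvg; exact: normed_cvg.
exists (fun a => limn (series (fun k => a k *: x k))), ((q - p) / (2 * C)), 1.
split; first by rewrite divr_gt0 ?subr_gt0 ?mulr_gt0.
split=> [lam a b ha hb|a ha].
  have -> : series (fun k => (lam * a k + b k) *: x k) =
      (fun n => lam *: series (fun k => a k *: x k) n + series (fun k => b k *: x k) n).
    apply/funext => n; rewrite /series/= scaler_sumr -big_split.
    by apply: eq_bigr => k _; rewrite /= scalerDl scalerA.
  apply: cvg_lim => //; apply: cvgD; last exact: scvg.
  by apply: cvgZr; exact: scvg.
split.
  have -> : `|limn (series (fun k => a k *: x k))| =
      limn (fun n => `|series (fun k => a k *: x k) n|).
    by apply/esym/cvg_lim => //; apply: cvg_norm; exact: scvg.
  have -> : (q - p) / (2 * C) * l1norm a =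
      limn (fun n => (q - p) / (2 * C) * series (fun k => `|a k|) n).
    by apply/esym/cvg_lim => //; apply: cvgMr; exact: ha.
  apply: ler_lim.
  - by apply: is_cvgMr; exact: ha.
  - by apply: is_cvg_norm; exact: scvg.
  - by near=> n; have := lower n a; rewrite /series/= !big_mkord.
rewrite mul1r; apply: le_trans (lim_series_norm (ncvg _ ha)) _.
apply: lim_series_le => //; first exact: ncvg.
by move=> n; rewrite /= normrZ -[leRHS]mulr1 ler_wpM2l.
Unshelve. all: by end_near. Qed.

Lemma functional_tb : ~ contains_l1 X ->
  universally_tb [set g | exists x : X, `|x| <= 1 /\ g = fun t => phi t x / C].
Proof.
move=> noL1 U mu UU mu_mean; apply: contrapT.
move=> /(mean_tbN_independent UU mu_mean)[|p [q [pq [g [gG g_ind]]]]].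
  move=> _ [x [x1 ->]] t; rewrite normrM normfV (gtr0_norm C0).
  by rewrite ler_pdivrMr// mul1r; apply: le_trans (phiC _ _) _; rewrite ger_pMr.
apply: noL1; have /choice[x hx] := gG.
apply: (@independent_contains_l1 x (p * C) (q * C)).
- by rewrite ltr_pM2r.
- by move=> n; case: (hx n).
move=> m eps; have [t ht] := g_ind m eps; exists t => i /ht.
by have [_ ->] := hx i; rewrite ler_pdivlMr// ler_pdivrMr.
Qed.

End DualFunctionals.

(** * Topology of the split set *)

Section PointwiseTopology.
Context {R : realType}.

Lemma ptws_eval_continuous (I : Type) (M : topologicalType) (i : I) :
  continuous (fun h : {ptws I -> M} => h i).
Proof. exact: (@proj_continuous {classic I} (fun=> M) i). Qed.

Lemma ptws_hausdorff (I : Type) (M : topologicalType) :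
  hausdorff_space M -> hausdorff_space {ptws I -> M}.
Proof. by move=> hM; apply: (@hausdorff_product {classic I} (fun=> M)). Qed.

Lemma ptws_compact (I : Type) (M : topologicalType) :
  compact [set: M] -> compact [set: {ptws I -> M}].
Proof.
move=> cM; have := @tychonoff {classic I} (fun=> M) (fun=> setT) (fun=> cM).
by congr compact; apply/seteqP; split.
Qed.

(** Pointwise compactness gives pointwise bounds, made uniform by Banach-Steinhaus. *)
Lemma dual_compact_bounded (X : completeNormedModType R) (D : set {ptws X -> R}) :
  compact D -> D `<=` in_dual (X := X) ->
  exists C : R, 0 < C /\ forall h x, D h -> `|h x| <= C * `|x|.
Proof.
move=> Dc Ddual.
have lin (h : X -> R^o) : D h -> linear h.
  by move=> /Ddual[hl _] a u v; exact: hl.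
have ub : uniform_bounded (D : set (X -> R^o)).
  apply: Banach_Steinhauss => [h Dh|x].
    split; last exact: lin.
    have [_ hc] := Ddual _ Dh.
    pose hL : {linear X -> R^o} :=
      HB.pack (h : X -> R^o) (GRing.isLinear.Build _ _ _ _ (h : X -> R^o) (lin h Dh)).
    exact: ((bounded_funP hL).2 (continuous_linear_bounded 0 (f := hL) (hc 0))).
  have : compact [set h x | h in D].
    apply: continuous_compact Dc; apply: continuous_subspaceT.
    exact: ptws_eval_continuous.
  move=> /(@compact_bounded R R^o)[B [_ hB]]; exists (B + 1) => h Dh.
  by apply: (hB (B + 1)); [rewrite ltrDl|exists h].
have [B hB] := ub 1; exists (`|B| + 1); split; first by rewrite ltr_wpDl.
move=> h x Dh; have [->|x0] := eqVneq x 0.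
  by have := (Ddual _ Dh).1 (-1) 0 0; rewrite scaler0 addr0 mulN1r addNr => ->;
    rewrite !normr0 mulr0.
have nx0 : 0 < `|x| by rewrite normr_gt0.
have /(hB h Dh) : `|(`|x|^-1 *: x)| <= 1.
  by rewrite normrZ normfV normr_id mulVf// gt_eqF.
have -> : h (`|x|^-1 *: x) = `|x|^-1 * h x.
  have h0 : h 0 = 0.
    by have := (Ddual _ Dh).1 (-1) 0 0; rewrite scaler0 addr0 mulN1r addNr.
  by have := (Ddual _ Dh).1 (`|x|^-1) x 0; rewrite !addr0 h0 addr0.
rewrite normrM normfV normr_id ler_pdivrMl// mulrC => /le_trans; apply.
by rewrite ler_wpM2r// -[leLHS]addr0 lerD// ler_norm.
Qed.

End PointwiseTopology.

Section SplitSet.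
Context {L M : topologicalType} {I : Type}.
Variables (r : I -> L) (f : I -> L -> M).
Hypotheses (L_haus : hausdorff_space L) (M_haus : hausdorff_space M).
Hypotheses (r_inj : injective r)
  (f_cont : forall i, {within ~` [set r i], continuous (f i)}).

(** By injectivity of [r] at most one index can use the left alternative. In this form the set is an
    intersection of one closed condition per index. *)
Lemma split_setE : split_set r f =
  [set x | forall i, x.1 = r i \/ x.2 i = f i x.1].
Proof.
apply/seteqP; split => [x [[i [xi hi]] j|[_ hx] i]|x hx]; last 1 first.
- have [[i xi]|xr] := pselect (exists i, x.1 = r i); [left|right].
    exists i; split=> // j ji; rewrite -xi; have [xj|//] := hx j.
    by case: ji; apply: r_inj; rewrite -xi -xj.
  have xr' i : x.1 <> r i by move=> xi; apply: xr; exists i.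
  by split=> // i; have [/xr'|] := hx i.
- have [->|ji] := pselect (j = i); first by left.
  by right; rewrite xi; exact: hi.
- by right; exact: hx.
Qed.

Lemma split_set_closed : closed (split_set r f).
Proof.
rewrite split_setE.
rewrite (_ : [set _ | _] = \bigcap_(i in setT)
   [set x : L * {ptws I -> M} | x.1 = r i \/ x.2 i = f i x.1]); last first.
  by apply/seteqP; split => x hx i; [move=> _; exact: hx|exact: (hx i Logic.I)].
apply: closed_bigI => i _; rewrite -openC openE => x /= hx.
have x1 : x.1 <> r i by move=> h; apply: hx; left.
have x2 : x.2 i <> f i x.1 by move=> h; apply: hx; right.
have := M_haus; rewrite open_hausdorff => /(_ (x.2 i) (f i x.1)).
move=> [|[A B] /= [/set_mem xA /set_mem xB] [oA oB /eqP AB]]; first exact/eqP.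
have nr : open (~` [set r i]).
  by rewrite openC; exact/accessible_closed_set1/hausdorff_accessible.
have fx : f i y @[y --> x.1] --> f i x.1.
  have := @f_cont i; rewrite continuous_open_subspace// => /(_ x.1).
  by apply; exact/mem_set.
have NB : nbhs x.1 [set y | y <> r i /\ B (f i y)].
  apply: filterI; first exact: (open_nbhs_nbhs (conj nr x1)).
  exact: fx (open_nbhs_nbhs (conj oB xB)).
have NA : nbhs x.2 [set h : {ptws I -> M} | A (h i)].
  exact: (@ptws_eval_continuous I M i x.2) (open_nbhs_nbhs (conj oA xA)).
exists ([set y | y <> r i /\ B (f i y)], [set h : {ptws I -> M} | A (h i)]).
  by split.
move=> y /= [[yr By] Ay] [//|yf].
suff : (A `&` B) (y.2 i) by rewrite AB.
by split => //; rewrite yf.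
Qed.

Lemma split_set_compact : compact [set: L] -> compact [set: M] ->
  compact (split_set r f).
Proof.
move=> cL cM; apply: subclosed_compact split_set_closed _ (@subsetT _ _).
by rewrite -setXTT; apply: compact_setX => //; exact: ptws_compact.
Qed.

End SplitSet.

Lemma compact_embedding_inverse (T U : topologicalType) (S : set T)
    (e : T -> U) (t0 : T) :
  compact S -> hausdorff_space U -> {within S, continuous e} ->
  (forall s t, S s -> S t -> e s = e t -> s = t) ->
  exists g : U -> T, [/\ g @` (e @` S) = S, {in S, cancel e g},
    {in e @` S, cancel g e} & {within e @` S, continuous g}].
Proof.
move=> Sc hU ec e_inj.
pose g u := if pselect (exists2 s, S s & e s = u) is left h
  then sval (cid2 h) else t0.
have ge s : S s -> g (e s) = s.
  move=> Ss; rewrite /g; case: pselect => [h|[]]; last by exists s.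
  by case: cid2 => /= t St et; exact: e_inj.
exists g; split.
- apply/seteqP; split => [_ [_ [s Ss <-] <-]|s Ss]; first by rewrite ge.
  by exists (e s); [exists s|rewrite ge].
- by move=> s /set_mem; exact: ge.
- by move=> _ /set_mem[s Ss <-]; rewrite ge.
apply/subspace_continuousP => _ [s Ss <-]. rewrite /from_subspace ge// => A.
rewrite nbhsE => -[B [oB Bs] BA].
have cSB : compact (S `&` ~` B) by apply: compact_closedI => //; exact: open_closedC.
have cl : closed (e @` (S `&` ~` B)).
  apply: compact_closed => //; apply: continuous_compact cSB.
  by apply: continuous_subspaceW ec => ? [].
have : nbhs (e s) (~` (e @` (S `&` ~` B))).
  apply: open_nbhs_nbhs; split; first exact: closed_openC.
  by move=> [t [St nBt] /e_inj ts]; apply: nBt; rewrite ts.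
apply: filterS => u /= hu [t St tu]; apply: BA; rewrite -tu ge//.
by apply: contrapT => nBt; apply: hu; exists t.
Qed.

Lemma interp_set_generator (R : realType) (P : Type) (G : set (P -> R)) g :
  G g -> interp_set G g.
Proof.
move=> Gg e e0; exists (Num.truncn e^-1).+1 => n ne.
exists 1, g; split; first exact: combination1.
  rewrite -ler_pdivrMr// mul1r; apply: le_trans (ltW (truncnS_gt _)) _.
  by rewrite -natrX ler_nat (leq_trans ne)// ltnW// ltn_expl.
by move=> x; rewrite subrr normr0 divr_ge0 ?exprn_ge0// ltW.
Qed.

Section ContinuityOnSubset.
Context {R : realType} {T : topologicalType} (S : set T).

(** Neighbourhoods are taken in the ambient space, so the subtype carries no topology of its own. *)
Definition subset_continuous (h : {x | S x} -> R) : Prop :=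
  forall p (d : R), 0 < d -> \forall t \near sval p,
    forall St : S t, `|h p - h (exist _ t St)| <= d.

Lemma subset_continuous_restrict (u : T -> R) :
  continuous u -> subset_continuous (fun p => u (sval p)).
Proof.
move=> uc p d d0; have /cvgrPdist_le/(_ d d0) := uc (sval p).
by apply: filterS => t h St.
Qed.

Lemma subset_continuous_combination (G : set ({x | S x} -> R)) s w :
  (forall g, G g -> subset_continuous g) -> combination G s w ->
  subset_continuous w.
Proof.
move=> Gc; elim=> [p d d0|c g {}s {}w Gg _ IH p d d0].
  by apply: nearW => t ?; rewrite subrr normr0 ltW.
have d1 : 0 < d / 2 / (`|c| + 1) by rewrite !divr_gt0// ltr_wpDl.
have d2 : 0 < d / 2 by rewrite divr_gt0.
apply: filterS2 (Gc _ Gg p _ d1) (IH p _ d2) => t h1 h2 St.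
rewrite opprD addrACA (splitr d) -mulrBr; apply: le_trans (ler_normD _ _) _.
apply: lerD => //; rewrite normrM.
apply: le_trans (ler_wpM2l (normr_ge0 c) (h1 St)) _.
rewrite mulrCA ger_pMr// ler_pdivrMr ?ltr_wpDl// mul1r.
by rewrite lerDl.
Qed.

(** Small gauges make [y] a uniform limit of combinations of continuous functions. *)
Lemma subset_continuous_interp (G : set ({x | S x} -> R)) y :
  (forall g, G g -> subset_continuous g) -> interp_set G y ->
  subset_continuous y.
Proof.
move=> Gc yG p d d0; have d3 : 0 < d / 3 by rewrite divr_gt0.
have [n hn] := yG _ d3.
have [s [w [sw _ yw]]] := hn n (leqnn n).
have {}yw q : `|y q - w q| <= d / 3.
  apply: le_trans (yw q) _; rewrite ler_pdivrMr ?exprn_gt0// ler_peMr ?(ltW d3)//.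
  by rewrite exprn_ege1// ler1n.
apply: filterS (subset_continuous_combination Gc sw p d3) => t h St.
set q := exist _ t St; have -> : y p - y q = (y p - w p) + (w p - w q) - (y q - w q).
  by ring.
apply: le_trans (ler_normB _ _) _; apply: le_trans (lerD (ler_normD _ _) (lexx _)) _.
by have := yw p; have := yw q; have := h St; lra.
Qed.

End ContinuityOnSubset.

(** * Embedding of the split set in the dual of the interpolation space *)

Theorem theorem7p5 (R : realType) (M : pseudoMetricType R) (L : topologicalType)
    (I : Type) (r : I -> L) (f : I -> L -> M) :
  hausdorff_space M -> compact [set: M] ->
  hausdorff_space L -> compact [set: L] ->
  injective r ->
  (forall i, {within ~` [set r i], continuous (f i)}) ->
  ~ has_M_independent_seq r f ->
  @weakly_RN R L ->
  weakly_RN_set (R := R) (split_set r f).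
Proof.
move=> hM cM hL cL r_inj f_cont f_free.
move=> [X [D [eL [gL [noL1 [Ddual [Dc [eLD [_ [eLK [_ [eLc _]]]]]]]]]]]].
have [C [C0 hC]] := dual_compact_bounded Dc Ddual.
have DeL l : D (eL l) by rewrite -eLD; exists l.
have eL_inj l l' : eL l = eL l' -> l = l'.
  by move=> ll'; rewrite -(eLK l) ?ll' ?eLK// inE.
pose T : topologicalType := (L * {ptws I -> M})%type.
(* An arbitrary value of [gL] provides a point of [L], hence a point of [S]. *)
set S : set T := split_set r f; pose l0 := gL (fun=> 0).
pose t0 : T := (l0, fun i => f i l0).
have S_E (t : T) : S t -> forall i, t.1 = r i \/ t.2 i = f i t.1.
  by rewrite /S split_setE.
have St0 : S t0 by rewrite /S split_setE// => i; right.
pose P := {t : T | S t}.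
pose proj (p : P) := (sval p).1; pose coord i (p : P) := (sval p).2 i.
pose GX := [set g | exists x : X, `|x| <= 1 /\
  g = fun p : P => eL (proj p) x / C].
pose GM := [set g | exists z i, g = fun p : P => cdist z (coord i p)].
pose G := GX `|` GM.
have G1 : bounded_by1 G.
  move=> _ [[x [x1 ->]]|[z [i ->]]] p.
    rewrite normrM normfV (gtr0_norm C0) ler_pdivrMr// mul1r.
    by apply: le_trans (hC _ _ (DeL _)) _; rewrite ger_pMr.
  by rewrite ger0_norm ?cdist_ge0 ?cdist_le1.
have Gtb : universally_tb G.
  move=> U mu UU mu_mean; apply: mean_tbU => //.
    apply: (functional_tb C0 _ _ noL1) => //.
      by move=> p x; exact: hC.
    by move=> p; exact: (Ddual _ (DeL (proj p))).1.
  apply: (coordinate_tb r_inj f_free) => // p i.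
  exact: S_E (svalP p) i.
have [Y [ev [ev_in ev_surj [norm_lt norm_le]]]] := interpolation_space G1.
have ev_bd y p : `|ev y p| <= 2 * `|y|.
  rewrite mulrC -ler_pdivrMr//; apply/ler_addgt0Pr => d d0.
  rewrite ler_pdivrMr// mulrC; apply: (gauge_ball_sup G1).
  by apply: norm_lt; rewrite ltrDl.
have Gc g : G g -> subset_continuous g.
  move=> [[x [_ ->]]|[z [i ->]]].
    apply: (@subset_continuous_restrict R T S (fun t => eL t.1 x / C)) => t.
    apply: cvgMl; apply: (cvg_comp (fun t : T => t.1) (fun l => eL l x)).
      exact: cvg_fst.
    have /subspace_continuousP/(_ t.1 Logic.I) := eLc.
    rewrite withinET => h.
    exact: (cvg_comp eL (fun h : {ptws X -> R} => h x) h (@ptws_eval_continuous X R x _)).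
  apply: (@subset_continuous_restrict R T S (fun t => cdist z (t.2 i))) => t.
  apply: (cvg_comp (fun t : T => t.2 i) (cdist z)); last exact: cdist_continuous.
  apply: (cvg_comp (fun t : T => t.2) (fun h : {ptws I -> M} => h i)).
    exact: cvg_snd.
  exact: ptws_eval_continuous.
(* Evaluation at [t], with the default value 0 off [S]. *)
pose e (t : T) : {ptws Y -> R} := fun y =>
  if pselect (S t) is left h then ev y (exist _ t h) else 0.
have eE t (St : S t) y : e t y = ev y (exist _ t St).
  by rewrite /e; case: pselect => // St'; rewrite (Prop_irrelevance St St').
have e_cont : {within S, continuous e}.
  apply/subspace_continuousP => t St; apply/pointwise_cvgP => y.
  apply/cvgrPdist_le => d d0.
  have := subset_continuous_interp Gc (ev_in y) (exist _ t St) d0.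
  apply: filterS => t' h St'.
  by have := h St'; rewrite -!eE.
have e_inj s t : S s -> S t -> e s = e t -> s = t.
  move=> Ss St est.
  (* Generators are themselves elements of [Y], so evaluations that coincide agree on all of [G]. *)
  have Gst g : G g -> g (exist _ s Ss) = g (exist _ t St).
    move=> /interp_set_generator/ev_surj[y <-].
    by rewrite -!eE est.
  case: s t Ss St est Gst => [s1 s2] [t1 t2] Ss St est Gst; congr (_, _).
    apply: eL_inj; apply/funext => x.
    have [h0 h0'] : eL s1 0 = 0 /\ eL t1 0 = 0.
      by split; [have := (Ddual _ (DeL s1)).1 (-1) 0 0|
                 have := (Ddual _ (DeL t1)).1 (-1) 0 0];
        rewrite scaler0 addr0 mulN1r addNr.
    have [->|x0] := eqVneq x 0; first by rewrite h0 h0'.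
    have nx0 : `|x| != 0 by rewrite normr_eq0.
    have : GX (fun p => eL (proj p) (`|x|^-1 *: x) / C).
      by exists (`|x|^-1 *: x); rewrite normrZ normfV normr_id mulVf.
    move=> gx; have := Gst _ (or_introl gx); move=> /= /(divIf (lt0r_neq0 C0)).
    have := (Ddual _ (DeL s1)).1 (`|x|^-1) x 0.
    have := (Ddual _ (DeL t1)).1 (`|x|^-1) x 0.
    rewrite !addr0 h0 h0' !addr0 /proj /= => -> ->.
    by move=> /(mulfI (invr_neq0 nx0)).
  apply/funext => i; apply: (cdist_eq0 hM).
  (* The centre is the coordinate of the first point, where the distance vanishes. *)
  have : GM (fun p => cdist (s2 i) (coord i p)) by exists (s2 i), i.
  by move=> gx; have := Gst _ (or_intror gx); rewrite /coord /= cdistxx.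
have Sc : compact S by exact: split_set_compact.
have RY : hausdorff_space {ptws Y -> R}.
  exact: ptws_hausdorff (@Rhausdorff R).
have [g [gS eK gK g_cont]] := compact_embedding_inverse t0 Sc RY e_cont e_inj.
exists Y, (e @` S), e, g; split.
  exact: (interp_no_l1 (exist _ t0 St0 : P) G1 Gtb ev_in norm_lt norm_le).
split; last by split=> //; exact: continuous_compact.
move=> _ [t St <-]; split=> [lam u v|y].
  by rewrite !(eE t St) linearP.
apply/cvgrPdist_le => d d0; near=> z.
rewrite !(eE t St).
have -> : ev y (exist _ t St) - ev z (exist _ t St) = ev (y - z) (exist _ t St).
  by rewrite linearB.
apply: le_trans (ev_bd _ _) _; rewrite mulrC -ler_pdivlMr//.
near: z; apply: (@cvgr_dist_le _ _ _ _ _ id y); first exact: cvg_id.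
by rewrite divr_gt0.
Unshelve. all: by end_near. Qed.
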